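(* For each $N$ let $\alpha_N\in(0,1)$ and let $Z^{(N)}$ be a random variable in $\{0,1\}^N$ with $\rho_A^{(N)}=\mathbb E\big[\prod_{j\in A}(-1)^{Z^{(N)}[j]}\big]$, $A\subseteq[N]$. Suppose $\alpha_N\to1$, $\rho_A^{(N)}\to1$ and that $$b_A:=\lim_{N\to\infty}\frac{\alpha_N}{1-\alpha_N}\big(1-\rho_A^{(N)}\big)$$ exists as a finite limit for all finite subsets $A\subset\{1,2,\dots\}$. Let $(g_A)$ be i.i.d. $N(0,1)$ random variables indexed by the finite subsets $A$ of $\{1,2,\dots\}$. Then a Gaussian field $\big(g^\infty_{x(C_x)}\big)$, for $x\in\{0,1\}^\infty$ and $C_x$ a finite subset of $\{1,2,\dots\}$, is well defined by $$g^\infty_{x(C_x)}:=2^{-|C_x|/2}\sum_{A\subseteq C_x,\,A\ne\emptyset}\ \prod_{j\in A}(-1)^{x[j]}\cdot\frac1{\sqrt{1+b_A}}\cdot g_A .$$ There is weak convergence, as $N\to\infty$, of $\big(g^{(N)}_{x(C_x)}\big)$ to $\big(g^\infty_{x(C_x)}\big)$, in the sense of convergence of finite-dimensional distributions. The process has independent increments, in the sense that $g^\infty_{x(C_x)}$ and $g^\infty_{y(C_y)}$ are independent if $C_x\cap C_y=\emptyset$.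
   Context: $[N]=\{1,\dots,N\}$. For each $N$, $(g_x)_{x\in\{0,1\}^N}$ is the zero mean Gaussian field with covariance $\mathrm{Cov}(g_x,g_y)=(1-\alpha_N)\sum_{t\ge0}\alpha_N^t\,\mathbb P(X_t=y\mid X_0=x)$, where $X_{t+1}=X_t+Z_t\bmod2$ with $(Z_t)$ i.i.d. copies of $Z^{(N)}$, $Z_t$ independent of $(X_\tau)_{\tau\le t}$. The centered field is $g_x^\circ=g_x-2^{-N}\sum_{y\in\{0,1\}^N}g_y$. For $C_x\subseteq[N]$ and $x(C_x)=(x[k];k\in C_x)$, $g^{(N)}_{x(C_x)}$ denotes the centered marginal average $2^{-(N-|C_x|)/2}\sum g_{x'}^\circ$, the sum being over $x'\in\{0,1\}^N$ with $x'[k]=x[k]$ for $k\in C_x$. For $x\in\{0,1\}^\infty$ and finite $C_x$ this is defined for all $N$ large enough that $C_x\subseteq[N]$. *)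

(* Defs.v *)
From HB Require Import structures.
From mathcomp Require Import all_boot all_order all_algebra finmap.
From mathcomp Require Import all_classical all_reals all_analysis.

Set Implicit Arguments.
Unset Strict Implicit.
Unset Printing Implicit Defensive.

Import Order.TTheory GRing.Theory Num.Theory.
Import numFieldNormedType.Exports.

Local Open Scope classical_set_scope.
Local Open Scope ring_scope.

Section independence.
Context {d d1 d2 : measure_display} {T : measurableType d} {R : realType}.
Variable P : probability T R.

Definition indep (T1 : measurableType d1) (T2 : measurableType d2)
    (X : T -> T1) (Y : T -> T2) : Prop :=
  forall (A : set T1) (B : set T2), measurable A -> measurable B ->
    P ((X @^-1` A) `&` (Y @^-1` B)) = (P (X @^-1` A) * P (Y @^-1` B))%E.

Definition mutual_indep (I : choiceType) (T1 : measurableType d1)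
    (X : I -> T -> T1) : Prop :=
  forall (J : {fset I}) (B : I -> set T1), (forall i, measurable (B i)) ->
    P (\bigcap_(i in [set` J]) (X i @^-1` B i)) =
    (\prod_(i <- J) P (X i @^-1` B i))%E.

End independence.

Section gaussian.
Context {d : measure_display} {T : measurableType d} {R : realType}.
Variable P : probability T R.

(* [normal_prob m 0] is the uniform law on [0, 1], not the point mass at [m];
   Gaussian fields may be degenerate, so the case [s = 0] is set apart. *)
Definition normal_law (m s : R) (B : set R) : \bar R :=
  if s == 0 then \d_m B else normal_prob m s B.

Definition gaussian_rv (X : T -> R) : Prop :=
  measurable_fun setT X /\
  exists m s : R, forall B : set R, measurable B ->
    P (X @^-1` B) = normal_law m s B.

Definition gaussian_field (I : Type) (G : I -> T -> R) : Prop :=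
  forall (n : nat) (i : 'I_n -> I) (a : 'I_n -> R),
    gaussian_rv (fun w => \sum_(j < n) a j * G (i j) w).

Definition centered_gaussian_field (I : Type) (K : I -> I -> R)
    (G : I -> T -> R) : Prop :=
  [/\ gaussian_field G,
      forall i, 'E_P[G i]%E = 0%E &
      forall i j, covariance P (G i) (G j) = (K i j)%:E].

Definition iid_standard_normal (I : choiceType) (G : I -> {RV P >-> R}) : Prop :=
  (forall i (B : set R), measurable B ->
    distribution P (G i) B = normal_prob 0 1 B) /\
  mutual_indep P (fun i => G i : T -> R).

End gaussian.

Definition cvg_fdd {R : realType} {d : nat -> measure_display}
    {T : forall N, measurableType (d N)} (P : forall N, probability (T N) R)
    {d' : measure_display} {T' : measurableType d'} (Q : probability T' R)
    (I : Type) (G : forall N, I -> T N -> R) (Ginf : I -> T' -> R) : Prop :=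
  forall (n : nat) (i : 'I_n -> I) (f : 'rV[R]_n -> R),
    continuous f -> (exists M : R, forall v, `|f v| <= M) ->
    ('E_(P N)[fun w => f (\row_j G N (i j) w)])%E @[N --> \oo] -->
    ('E_Q[fun w => f (\row_j Ginf (i j) w)])%E.

(* Coordinates are numbered from 0: [{1, ..., N}] is ['I_N], [{1, 2, ...}] is
   [nat], and [{0,1}^oo] is [nat -> bool].  The sigma-algebra of
   [N.-tuple bool] is the power set. *)
Section hypercube.
Context {R : realType}.

Definition addmod2 (N : nat) (x z : N.-tuple bool) : N.-tuple bool :=
  [tuple tnth x k (+) tnth z k | k < N].

Section walk.
Context {d : measure_display} {T : measurableType d} (P : probability T R).
Variables (N : nat) (Z : {RV P >-> N.-tuple bool}).

(* [rho Z A] only depends on the part of [A] inside [{0, ..., N-1}]. *)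
Definition rho (A : {fset nat}) : R :=
  fine 'E_P[fun w => (\prod_(j < N | val j \in A) (-1) ^+ tnth (Z w) j)%R]%E.

(* The law of [X 0] is arbitrary except that it charges every vertex, so that
   conditioning on [X 0 = x] is elementary. *)
Definition walk (X : nat -> {RV P >-> N.-tuple bool})
    (S : nat -> {RV P >-> N.-tuple bool}) : Prop :=
  [/\ forall x, (0 < P (X 0%N @^-1` [set x]))%E,
      forall t w, X t.+1 w = addmod2 (X t w) (S t w),
      forall t (B : set (N.-tuple bool)), measurable B ->
        distribution P (S t) B = distribution P Z B,
      mutual_indep P (fun t => S t : T -> N.-tuple bool) &
      forall t, indep P (S t) (fun w => [tuple X (val tau) w | tau < t.+1])].

Definition transition (X : nat -> {RV P >-> N.-tuple bool})
    (t : nat) (x y : N.-tuple bool) : R :=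
  fine (P ((X t @^-1` [set y]) `&` (X 0%N @^-1` [set x]))) /
  fine (P (X 0%N @^-1` [set x])).

Definition walk_cov (alpha : R) (X : nat -> {RV P >-> N.-tuple bool})
    (x y : N.-tuple bool) : R :=
  (1 - alpha) * limn (series (fun t => alpha ^+ t * transition X t x y)).

End walk.

Section marginal.
Context {T : Type} (N : nat).
Variable g : N.-tuple bool -> T -> R.

Definition centered (x : N.-tuple bool) (w : T) : R :=
  g x w - (2 ^+ N)^-1 * \sum_(y : N.-tuple bool) g y w.

(* Meant for [C] included in [{0, ..., N-1}]; the value is irrelevant
   otherwise. *)
Definition marginal (x : nat -> bool) (C : {fset nat}) (w : T) : R :=
  2 `^ (- (N%:R - #|` C|%:R) / 2) *
  \sum_(x' : N.-tuple bool |
        [forall k : 'I_N, (val k \in C) ==> (tnth x' k == x k)])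
    centered x' w.

End marginal.

Definition ginfty {T : Type} (b : {fset nat} -> R) (gA : {fset nat} -> T -> R)
    (x : nat -> bool) (C : {fset nat}) (w : T) : R :=
  2 `^ (- #|` C|%:R / 2) *
  \sum_(A <- fpowerset C | A != fset0)
    (\prod_(j <- A) (-1) ^+ x j) * (Num.sqrt (1 + b A))^-1 * gA A w.

End hypercube.

(* Main.v *)
Require Import Defs.
From HB Require Import structures.
From mathcomp Require Import all_boot all_order all_algebra finmap.
From mathcomp Require Import all_classical all_reals all_analysis.
From mathcomp Require Import measurable_realfun ring lra.

Set Implicit Arguments.
Unset Strict Implicit.
Unset Printing Implicit Defensive.

Import Order.TTheory GRing.Theory Num.Theory.
Import numFieldNormedType.Exports.

Local Open Scope classical_set_scope.
Local Open Scope ring_scope.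

(** The Walsh functions w_A(x), the products of (-1)^x[j] over j in A, are
    eigenvectors of the walk: one step multiplies w_A by rho_A. Summing the
    geometric series in the covariance of the field therefore gives

      Cov(g_x, g_y) = 2^-N sum_A w_A(x) w_A(y) (1 - alpha) / (1 - alpha rho_A)

    ([walk_cov_walsh]), and each weight equals 1 / (1 + b_A^N) where
    b_A^N = alpha / (1 - alpha) (1 - rho_A) is the quantity that converges to
    b_A ([prelimit_bE]). Averaging over a subcube with fixed coordinates C
    annihilates every w_A with A not inside C, and centring the field removes
    the empty set ([walsh_marginal_coef]). So, as soon as the sets C_j lie in
    the first N coordinates, finitely many marginals have exactly the
    covariance of the variables [ginfty] with b^N in place of b
    ([marginal_cos], [ginfty_cos]).

    Centred Gaussian vectors with the same covariance have the same law. Hence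
    the expectation of a bounded continuous function of the marginals is, for
    large N, the expectation of the same function of the variables [ginfty] with
    parameter b^N. These live on one fixed probability space and converge
    pointwise as b^N tends to b, and dominated convergence concludes. The limit
    theorem thus reduces to a statement of uniqueness of laws.

    Uniqueness is proved for the functions cos (a . v + c) of a vector v
    ([trig_determines_expectation]). Two laws that agree on these agree on every
    function obtained from them by linear combinations and bounded pointwise
    limits. As products of cosines are sums of cosines, this class is an
    algebra; it contains the sign of each of its members, because an iterated
    cubic polynomial converges to the sign on [-1, 1]; it contains half-spaces,
    because the sign of sin (t / k) tends to the sign of t; and then it contains
    indicators of boxes and, by rounding, all bounded continuous functions.

    The characteristic function of the normal law is the solution of a linear
    differential equation, which Stein's identity provides ([stein_identity],
    [cos_normal]); that identity also gives the two moments which identify the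
    parameters of a Gaussian variable ([gaussian_cos]). For independent standard
    normal variables the addition formula for the cosine then gives the
    characteristic function of a linear combination ([iid_normal_cos]). It shows
    that the limiting field is Gaussian ([combination_gaussian]), and that two
    combinations with disjoint index sets are independent
    ([combination_indep]); the latter applies to disjoint C_x and C_y, as no
    nonempty set is contained in both. *)

(** * Expectations of bounded random variables *)

Section bounded_expectation.
Context {R : realType} {d : measure_display} {T : measurableType d}.
Variable P : probability T R.

Lemma bounded_integrable (f : T -> R) : measurable_fun setT f ->
  (exists M, forall w, `|f w| <= M) -> P.-integrable setT (EFin \o f).
Proof.
move=> mf [M fM]; apply: measurable_bounded_integrable => //.
  by apply: le_lt_trans (probability_le1 P measurableT) _; rewrite ltry.
exists M; split; first exact: num_real.
by move=> x Mx w _ /=; rewrite (le_trans (fM w))// ltW.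
Qed.

Lemma cvg_measurable (f_ : nat -> T -> R) (f : T -> R) :
  (forall n, measurable_fun setT (f_ n)) ->
  (forall w, f_ n w @[n --> \oo] --> f w) -> measurable_fun setT f.
Proof.
move=> mf_ f_f; apply/measurable_EFinP.
apply: (@emeasurable_fun_cvg _ _ _ _ (fun n => EFin \o f_ n)) => //.
- by move=> n; exact/measurable_EFinP.
- by move=> w _; apply: cvg_EFin; [exact: nearW|exact: f_f].
Qed.

Lemma cvg_norm_le (M : R) (u : nat -> R) (l : R) :
  (forall n, `|u n| <= M) -> u n @[n --> \oo] --> l -> `|l| <= M.
Proof.
move=> uM ul; have nul : `|u n| @[n --> \oo] --> `|l| by exact: cvg_norm.
rewrite -(cvg_lim _ nul)//; apply: limr_le; last exact: nearW.
by apply/cvg_ex; exists `|l|.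
Qed.

Lemma cvg_bounded_Rintegral (M : R) (f_ : nat -> T -> R) (f : T -> R) :
  (forall n, measurable_fun setT (f_ n)) ->
  (forall n w, `|f_ n w| <= M) ->
  (forall w, f_ n w @[n --> \oo] --> f w) ->
  \int[P]_w f_ n w @[n --> \oo] --> \int[P]_w f w.
Proof.
move=> mf_ f_M f_f; have mf := cvg_measurable mf_ f_f.
have fM w : `|f w| <= M by exact: cvg_norm_le (f_f w).
rewrite /Rintegral; apply: fine_cvg.
rewrite fineK; last first.
  by apply: integrable_fin_num => //; apply: bounded_integrable => //; exists M.
apply: (@dominated_cvg _ _ _ _ _ _ (fun n => EFin \o f_ n) _ (cst M%:E)) => //.
- by move=> n; exact/measurable_EFinP.
- by move=> w _; apply: cvg_EFin; [exact: nearW|exact: f_f].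
- apply: (bounded_integrable (f := cst M)) => //.
  by exists `|M| => w.
- by move=> n w _; rewrite lee_fin.
Qed.

Lemma expectation_Rintegral (f : T -> R) : P.-integrable setT (EFin \o f) ->
  'E_P[f]%E = (\int[P]_w f w)%:E.
Proof.
by move=> fi; rewrite unlock /Rintegral fineK//; exact: integrable_fin_num.
Qed.

End bounded_expectation.

(** * Closure of a class of functions under bounded pointwise limits *)

Section bounded_limits.
Context {R : realType} {T : Type}.
Implicit Types (B : (T -> R) -> Prop) (f g : T -> R).

(** The functions generated by a class under linear combinations and pointwise
    limits with a common bound: identities between expectations propagate from
    the class to all of them. *)
Inductive bcl B : (T -> R) -> Prop :=
| bcl_base f : B f -> bcl B f
| bcl_lin a f g : bcl B f -> bcl B g -> bcl B (fun x => a * f x + g x)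
| bcl_lim M (f_ : nat -> T -> R) f : (forall n, bcl B (f_ n)) ->
    (forall n x, `|f_ n x| <= M) -> (forall x, f_ n x @[n --> \oo] --> f x) ->
    bcl B f.

Definition bounded_class B :=
  forall f, B f -> exists M : R, forall x, `|f x| <= M.

Lemma bcl_bounded B : bounded_class B -> bounded_class (bcl B).
Proof.
move=> bB f; elim=> [g /bB//|a g h _ [M gM] _ [N hN]|M f_ g _ _ f_M f_g].
- exists (`|a| * M + N) => x; rewrite (le_trans (ler_normD _ _))// normrM.
  by rewrite lerD ?hN// ler_wpM2l.
- by exists M => x; exact: cvg_norm_le (f_g x).
Qed.

Section linear.
Variable B : (T -> R) -> Prop.
Hypothesis B1 : bcl B (fun=> 1).

Lemma bcl_cst c : bcl B (fun=> c).
Proof.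
have -> : (fun=> c) = (fun x : T => (c - 1) * 1 + 1 :> R).
  by apply/funext => x; ring.
exact: bcl_lin.
Qed.

Lemma bclZ a f : bcl B f -> bcl B (fun x => a * f x).
Proof.
move=> fB; have -> : (fun x => a * f x) = (fun x => a * f x + 0).
  by apply/funext => x; rewrite addr0.
by apply: bcl_lin => //; exact: bcl_cst.
Qed.

Lemma bclD f g : bcl B f -> bcl B g -> bcl B (fun x => f x + g x).
Proof.
move=> fB gB; have -> : (fun x => f x + g x) = (fun x => 1 * f x + g x).
  by apply/funext => x; rewrite mul1r.
exact: bcl_lin.
Qed.

Lemma bclB f g : bcl B f -> bcl B g -> bcl B (fun x => f x - g x).
Proof.
move=> fB gB; have -> : (fun x => f x - g x) = (fun x => -1 * g x + f x).
  by apply/funext => x; ring.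
exact: bcl_lin.
Qed.

Lemma bcl_sum (I : Type) (r : seq I) (Q : pred I) (F : I -> T -> R) :
  (forall i, Q i -> bcl B (F i)) ->
  bcl B (fun x => \sum_(i <- r | Q i) F i x).
Proof.
move=> FB; elim: r => [|i r ih].
  by under eq_fun do rewrite big_nil; exact: bcl_cst.
under eq_fun do rewrite big_cons.
by case: (boolP (Q i)) => // Qi; apply: bclD => //; exact: FB.
Qed.

End linear.

(** The product of two limits is a limit of products because uniformly bounded
    convergence is preserved by multiplication with a fixed bounded function;
    both factors are therefore handled one after the other. *)
Lemma bclM B f g : bounded_class B ->
  (forall f g, B f -> B g -> bcl B (fun x => f x * g x)) ->
  bcl B f -> bcl B g -> bcl B (fun x => f x * g x).
Proof.
move=> bB BM fB gB.
elim: fB => {f} [f Bf|a f h fB fgB hB hgB|M f_ f f_B fg_B f_M f_f].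
- elim: gB => {g} [g Bg|a g h gB fgB hB fhB|M g_ g g_B fg_B g_M g_g].
  + exact: BM.
  + have -> : (fun x => f x * (a * g x + h x)) =
              (fun x => a * (f x * g x) + f x * h x).
      by apply/funext => x; ring.
    exact: bcl_lin.
  + have [N fN] := bB _ Bf.
    apply: (@bcl_lim _ (N * M) (fun n x => f x * g_ n x)) => //.
    * by move=> n x; rewrite normrM ler_pM.
    * by move=> x; apply: cvgM => //; exact: cvg_cst.
- have -> : (fun x => (a * f x + h x) * g x) =
            (fun x => a * (f x * g x) + h x * g x).
    by apply/funext => x; ring.
  exact: bcl_lin.
- have [N gN] := bcl_bounded bB gB.
  apply: (@bcl_lim _ (M * N) (fun n x => f_ n x * g x)) => //.
  * by move=> n x; rewrite normrM ler_pM.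
  * by move=> x; apply: cvgM => //; exact: cvg_cst.
Qed.

End bounded_limits.

(** The cubic has the fixed points -1, 0, 1 and pushes the rest of [-1, 1]
    away from 0, so that its iterates are polynomials converging boundedly to
    the sign. *)
Definition smoothstep {R : realType} (t : R) : R := (3 * t - t ^+ 3) / 2.

Section smoothstep.
Context {R : realType}.
Implicit Types t : R.

Lemma smoothstep_itv t : 0 <= t <= 1 -> t <= smoothstep t <= 1.
Proof.
rewrite /smoothstep => /andP[t0 t1].
have h1 : 0 <= t * ((1 - t) * (1 + t)) by rewrite !mulr_ge0//; lra.
have h2 : 0 <= (1 - t) ^+ 2 * (2 + t) by rewrite mulr_ge0// ?sqr_ge0//; lra.
by apply/andP; split; rewrite -subr_ge0; lra.
Qed.

Lemma smoothstepN t : smoothstep (- t) = - smoothstep t.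
Proof. by rewrite /smoothstep; field. Qed.

Lemma iter_smoothstepN n t :
  iter n smoothstep (- t) = - iter n smoothstep t.
Proof. by elim: n => //= n ->; rewrite smoothstepN. Qed.

Lemma iter_smoothstep_itv n t : 0 <= t <= 1 ->
  t <= iter n smoothstep t <= 1.
Proof.
move=> /andP[t0 t1]; elim: n => [|n /andP[ih1 ih2]] /=; first by rewrite lexx.
have /andP[s1 s2] : iter n smoothstep t <= smoothstep (iter n smoothstep t) <= 1.
  by rewrite smoothstep_itv// ih2 (le_trans t0).
by rewrite s2 (le_trans ih1).
Qed.

(** The distance to 1 shrinks at least by the factor 1 - t / 2 in every step,
    since the iterates stay above t. *)
Lemma iter_smoothstep_cvg1 t : 0 < t <= 1 ->
  iter n smoothstep t @[n --> \oo] --> (1 : R).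
Proof.
move=> /andP[t0 t1].
have rate n : 1 - iter n smoothstep t <= (1 - t / 2) ^+ n.
  elim: n => [|n ih] /=; first by rewrite expr0; lra.
  have /andP[i1 i2] : t <= iter n smoothstep t <= 1.
    by rewrite iter_smoothstep_itv// (ltW t0).
  rewrite exprS; apply: (@le_trans _ _ ((1 - t / 2) * (1 - iter n smoothstep t))).
    rewrite /smoothstep; set s := iter _ _ _ in i1 i2 *.
    have h1 : 0 <= (1 - s) * (s - t) by rewrite mulr_ge0//; lra.
    have h2 : 0 <= (1 - s) * s ^+ 2 by rewrite mulr_ge0// ?sqr_ge0//; lra.
    by rewrite -subr_ge0; lra.
  by apply: ler_wpM2l => //; lra.
apply: (@squeeze_cvgr _ _ _ _ (fun n => 1 - (1 - t / 2) ^+ n) (fun=> 1)).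
- apply: nearW => n; have t01 : 0 <= t <= 1 by rewrite ltW.
  have /andP[_ ->] := iter_smoothstep_itv n t01.
  by rewrite andbT lerBlDl -lerBlDr.
- rewrite -[X in _ --> X]subr0; apply: cvgB; first exact: cvg_cst.
  by apply: cvg_expr; rewrite ger0_norm; lra.
- exact: cvg_cst.
Qed.

Lemma iter_smoothstep0 n : iter n smoothstep (0 : R) = 0.
Proof. by elim: n => //= n ->; rewrite /smoothstep; field. Qed.

Lemma iter_smoothstep_le1 n t : `|t| <= 1 -> `|iter n smoothstep t| <= 1.
Proof.
wlog t0 : t / 0 <= t => [hw|].
  have [|t0] := leP 0 t; first exact: hw.
  have : 0 <= - t by rewrite oppr_ge0 ltW.
  by move=> /hw; rewrite iter_smoothstepN !normrN.
rewrite ger0_norm// => t1.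
have /andP[i1 i2] : t <= iter n smoothstep t <= 1.
  by rewrite iter_smoothstep_itv// t0.
by rewrite ger0_norm// (le_trans t0).
Qed.

Lemma iter_smoothstep_sg t : `|t| <= 1 ->
  iter n smoothstep t @[n --> \oo] --> Num.sg t.
Proof.
have [t0|t0|->] := ltgtP t 0; last first.
- by move=> _; under eq_fun do rewrite iter_smoothstep0; rewrite sgr0; exact: cvg_cst.
- rewrite gtr0_norm// => t1; rewrite gtr0_sg//.
  by apply: iter_smoothstep_cvg1; rewrite t0.
- rewrite ltr0_norm// => t1; rewrite ltr0_sg//.
  rewrite -[t]opprK; under eq_fun do rewrite iter_smoothstepN.
  by apply: cvgN; apply: iter_smoothstep_cvg1; rewrite t1 andbT oppr_gt0.
Qed.

End smoothstep.

Section bounded_limit_algebra.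
Context {R : realType} {T : Type}.
Variable B : (T -> R) -> Prop.
Hypothesis bB : bounded_class B.
Hypothesis BM : forall f g, B f -> B g -> bcl B (fun x => f x * g x).
Hypothesis B1 : bcl B (fun=> 1).

(** After normalisation by a bound, the sign is a bounded limit of polynomials
    without constant term in the function. *)
Lemma bcl_sg f : bcl B f -> bcl B (fun x => Num.sg (f x)).
Proof.
move=> fB; have [M fM] := bcl_bounded bB fB.
pose K := `|M| + 1; have K0 : 0 < K by rewrite /K ltr_wpDl.
have -> : (fun x => Num.sg (f x)) = (fun x => Num.sg (K^-1 * f x)).
  by apply/funext => x; rewrite sgrM (@gtr0_sg _ K^-1) ?invr_gt0// mul1r.
have fK x : `|K^-1 * f x| <= 1.
  rewrite normrM gtr0_norm ?invr_gt0// mulrC ler_pdivrMr// mul1r.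
  by rewrite (le_trans (fM x))// /K (le_trans (ler_norm M))// lerDl.
apply: (@bcl_lim _ _ _ 1 (fun n x => iter n smoothstep (K^-1 * f x))).
- elim=> [|n ih] /=; first exact: bclZ.
  set g := (fun x => iter n smoothstep (K^-1 * f x)) in ih *.
  have -> : (fun x => smoothstep (g x)) =
      (fun x => 3 / 2 * g x + - 2^-1 * (g x * (g x * g x))).
    by apply/funext => x; rewrite /smoothstep; field.
  apply: bclD => //; apply: bclZ => //.
  by apply: bclM => //; exact: bclM.
- by move=> n x; exact: iter_smoothstep_le1.
- by move=> x; exact: iter_smoothstep_sg.
Qed.

Lemma bcl_gt0 f : bcl B f -> bcl B (fun x => (0 < f x)%R%:R).
Proof.
move=> fB; have sB := bcl_sg fB.
have -> : (fun x => (0 < f x)%R%:R) =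
    (fun x => 2^-1 * (Num.sg (f x) + Num.sg (f x) * Num.sg (f x))).
  apply/funext => x; have [fx|fx|<-] := ltgtP 0 (f x).
  - by rewrite gtr0_sg//=; lra.
  - by rewrite ltr0_sg//=; lra.
  - by rewrite sgr0/=; lra.
by apply: bclZ => //; apply: bclD => //; exact: bclM.
Qed.

Lemma bcl_prod (I : Type) (r : seq I) (F : I -> T -> R) :
  (forall i, bcl B (F i)) -> bcl B (fun x => \prod_(i <- r) F i x).
Proof.
move=> FB; elim: r => [|i r ih].
  by under eq_fun do rewrite big_nil.
by under eq_fun do rewrite big_cons; exact: bclM.
Qed.

(** The sets whose indicator lies in the closure form a sigma-algebra:
    complements and intersections are differences and products of indicators,
    and countable intersections are bounded limits of products. *)
Lemma bcl_indic (phi : T -> R) :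
  (forall u, bcl B (fun x => (u < phi x)%R%:R)) ->
  forall A : set R, measurable A -> bcl B (fun x => \1_A (phi x)).
Proof.
move=> ray A; rewrite [measurable]measurable_realfun.RGenOInfty.measurableE.
have bclC (E : set R) :
    bcl B (fun x => \1_E (phi x)) -> bcl B (fun x => \1_(~` E) (phi x)).
  move=> EB; have -> : (fun x => \1_(~` E) (phi x)) =
      (fun x => 1 - \1_E (phi x)) :> (T -> R).
    by apply/funext => x; rewrite !indicE in_setC; case: (_ \in _); rewrite /= ?subr0 ?subrr.
  exact: bclB.
apply: (@smallest_sub _ _ _ [set E | bcl B (fun x => \1_E (phi x))]);
    last first.
  move=> _ [u ->] /=; have -> // : (fun x => \1_`]u, +oo[ (phi x)) =
      (fun x => (u < phi x)%R%:R) :> (T -> R).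
  by apply/funext => x; rewrite indicE mem_setE in_itv /= andbT.
split.
- by rewrite /= indic0; exact: bcl_cst.
- by move=> E EB; rewrite setTD; exact: bclC.
- move=> F FB /=.
  have -> : (fun x => \1_(\bigcup_i F i) (phi x)) =
      (fun x => 1 - \1_(~` \bigcup_i F i) (phi x)) :> (T -> R).
    by apply/funext => x; rewrite !indicE in_setC; case: (_ \in _); rewrite /= ?subr0 ?subrr.
  apply: bclB => //.
  (* a union is the complement of the intersection of the complements *)
  apply: (@bcl_lim _ _ _ 1
      (fun n x => \prod_(i <- iota 0 n) \1_(~` F i) (phi x))).
  + by move=> n; apply: bcl_prod => i; apply: bclC; exact: FB.
  + move=> n x; rewrite normr_prod; elim: (iota 0 n) => [|i r ih].
      by rewrite big_nil.
    rewrite big_cons mulr_ile1// ?prodr_ge0// indicE.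
    by case: (_ \in _); rewrite ?normr1 ?normr0.
  + move=> x; have [[i _ Fi]|nF] := pselect ((\bigcup_i F i) (phi x)).
      rewrite indicE memNset; last by apply; exists i.
      apply/cvg_ballP => e e0; near=> n.
      rewrite (_ : \prod_(_ <- _) _ = 0); first exact: ballxx.
      have ni : i \in iota 0 n.
        by rewrite mem_iota add0n /=; near: n; exact: nbhs_infty_gt.
      by rewrite (big_rem i)//= indicE memNset ?mul0r//; apply.
    rewrite indicE mem_set//.
    rewrite (_ : (fun n => _) = (fun=> 1)); first exact: cvg_cst.
    apply/funext => n; rewrite big1// => i _.
    by rewrite indicE mem_set// => Fi; apply: nF; exists i.
Unshelve. all: by end_near. Qed.

End bounded_limit_algebra.

Lemma cvg_rV {R : realType} (n : nat) (u : nat -> 'rV[R]_n) (v : 'rV[R]_n) :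
  (forall j, u k 0 j @[k --> \oo] --> v 0 j) -> u k @[k --> \oo] --> v.
Proof.
move=> uv A [P vP PA].
have : \forall k \near \oo, forall j, P 0 j (u k 0 j).
  by apply: filter_forall => j; exact: uv (vP 0 j).
by apply: filterS => k Pk; apply: PA => i j; rewrite (ord1 i).
Qed.

Section continuous_functions.
Import HBSimple.
Context {R : realType} {T : Type}.
Variable B : (T -> R) -> Prop.
Hypothesis bB : bounded_class B.
Hypothesis BM : forall f g, B f -> B g -> bcl B (fun x => f x * g x).
Hypothesis B1 : bcl B (fun=> 1).

(** Rounding every coordinate with a simple function of one real variable turns
    a function of several variables into a finite combination of indicators of
    boxes. *)
Lemma bcl_continuous (n : nat) (phi : T -> 'rV[R]_n) (F : 'rV[R]_n -> R) :
  (forall j u, bcl B (fun x => (u < phi x 0 j)%R%:R)) ->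
  continuous F -> (exists M, forall v, `|F v| <= M) ->
  bcl B (fun x => F (phi x)).
Proof.
move=> ray cF [M FM].
have [s s_id] : exists s : {sfun measurableTypeR R >-> R}^nat,
    forall t : R, s k t @[k --> \oo] --> t.
  have mid : measurable_fun setT (EFin : measurableTypeR R -> \bar R).
    exact/measurable_EFinP.
  have [s hs] := approximation_sfun measurableT mid.
  exists s => t; have /fine_cvg := hs t I; exact.
apply: (@bcl_lim _ _ _ M (fun k x => F (\row_j s k (phi x 0 j)))).
- move=> k.
  have [r ur rE] : exists2 r : seq R, uniq r & forall t, s k t \in r.
    have /finite_seqP[r0 r0E] : finite_set (range (s k)) by exact: fimfunP.
    exists (undup r0); first exact: undup_uniq.
    move=> t; rewrite mem_undup.
    suff : [set` r0] (s k t) by [].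
    by rewrite -r0E; exists t.
  (* the boxes are indexed by the choice K of one value in every coordinate *)
  pose e (i : 'I_(size r)) := s k @^-1` [set r`_i].
  have -> : (fun x => F (\row_j s k (phi x 0 j))) =
      (fun x => \sum_(K : {ffun 'I_n -> 'I_(size r)})
         F (\row_j r`_(K j)) * \prod_(j <- enum 'I_n) \1_(e (K j)) (phi x 0 j)).
    apply/funext => x.
    have hK j : (index (s k (phi x 0%R j)) r < size r)%N by rewrite index_mem.
    pose K0 : {ffun 'I_n -> 'I_(size r)} := [ffun j => Ordinal (hK j)].
    rewrite (bigD1 K0)//= [X in _ + X]big1 ?addr0.
      rewrite big1 ?mulr1; first congr F.
        by apply/rowP => j; rewrite !mxE ffunE /= nth_index.
      by move=> j _; rewrite indicE mem_set// ffunE /e /= nth_index.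
    move=> K KK0; rewrite (_ : \prod_(_ <- _) _ = 0) ?mulr0//.
    have [j Kj] : exists j, K j <> K0 j.
      by apply/existsNP => h; apply: (elimN eqP KK0); apply/ffunP => j; exact: h.
    rewrite (big_rem j) ?mem_enum//= indicE memNset ?mul0r// /e /= => sE.
    apply: Kj; apply/val_inj; rewrite /= ffunE /= sE.
    by rewrite index_uniq.
  apply: bcl_sum => // K _; apply: bclZ => //.
  apply: bcl_prod => // j; apply: bcl_indic => //.
  exact: (measurable_funPTI (s k) (measurable_set1 _)).
- by move=> k x.
- move=> x; apply: continuous_cvg; first exact: cF.
  apply: cvg_rV => j; rewrite (_ : (fun k => _) = s^~ (phi x 0 j)) //.
  by apply/funext => k; rewrite mxE.
Qed.

End continuous_functions.

(** * Trigonometric functions determine the law *)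

(** The cosines with a phase, so that sines are included. *)
Definition trig {R : realType} {T : Type} (n : nat) (phi : 'I_n -> T -> R)
    (f : T -> R) : Prop :=
  exists a c, f = fun x => cos (\sum_(j < n) a j * phi j x + c).

Section trig.
Context {R : realType} {T : Type} (n : nat).
Variable phi : 'I_n -> T -> R.

Lemma trig_bounded : bounded_class (trig phi).
Proof. by move=> _ [a [c ->]]; exists 1 => x; rewrite ler_norml cos_geN1 cos_le1. Qed.

Lemma cosM (x y : R) : cos x * cos y = 2^-1 * cos (x - y) + 2^-1 * cos (x + y).
Proof. by rewrite cosB cosD; field. Qed.

Lemma bcl_trig_one : bcl (trig phi) (fun=> 1).
Proof.
apply: bcl_base; exists (fun=> 0), 0; apply/funext => x.
by rewrite big1 ?addr0 ?cos0// => j _; rewrite mul0r.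
Qed.

Lemma trigM f g : trig phi f -> trig phi g -> bcl (trig phi) (fun x => f x * g x).
Proof.
move=> [a [c ->]] [b [e ->]].
under eq_fun do rewrite cosM.
apply: bclD; apply: (bclZ bcl_trig_one); apply: bcl_base.
- exists (fun j => a j - b j), (c - e); apply/funext => x; congr cos.
  by under [in RHS]eq_bigr do rewrite mulrBl; rewrite sumrB; ring.
- exists (fun j => a j + b j), (c + e); apply/funext => x; congr cos.
  by under [in RHS]eq_bigr do rewrite mulrDl; rewrite big_split/=; ring.
Qed.

Lemma cvg_sg_sin (y : R) :
  Num.sg (sin (k.+1%:R^-1 * y)) @[k --> \oo] --> Num.sg y.
Proof.
apply/cvg_ballP => e e0; near=> k.
rewrite (_ : Num.sg (sin _) = Num.sg y); first exact: ballxx.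
have k0 : 0 < k.+1%:R^-1 :> R by rewrite invr_gt0.
have yk : `|y| < k.+1%:R * 2.
  rewrite -ltr_pdivrMr//; near: k.
  exists (Num.truncn (`|y| / 2)) => // k /= yk.
  have := truncnS_gt (`|y| / 2) => /lt_le_trans; apply.
  by rewrite ler_nat ltnS.
have [y0|y0|->] := ltgtP y 0.
- rewrite (ltr0_sg y0) -[y]opprK mulrN sinN sgrN gtr0_sg//; apply: sin2_gt0.
  rewrite mulr_gt0// ?oppr_gt0//=.
  by rewrite mulrC ltr_pdivrMr// mulrC -(ltr0_norm y0).
- rewrite (gtr0_sg y0) gtr0_sg//; apply: sin2_gt0.
  rewrite mulr_gt0//=.
  by rewrite mulrC ltr_pdivrMr// mulrC -(gtr0_norm y0).
- by rewrite mulr0 sin0.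
Unshelve. all: by end_near. Qed.

(** A half-line is reached from the periodic functions because, at a given
    point, a sine of large period has the sign of its argument. *)
Lemma bcl_trig_ray j u : bcl (trig phi) (fun x => (u < phi j x)%R%:R).
Proof.
pose f := fun x => Num.sg (phi j x - u).
have fB : bcl (trig phi) f.
  apply: (@bcl_lim _ _ _ 1
      (fun k x => Num.sg (sin (k.+1%:R^-1 * (phi j x - u))))).
  - move=> k; apply: (bcl_sg trig_bounded trigM bcl_trig_one); apply: bcl_base.
    exists (fun i => (i == j)%:R * k.+1%:R^-1), (- (k.+1%:R^-1 * u) - pi / 2).
    apply/funext => x; rewrite addrA cosBpihalf; congr sin.
    rewrite (bigD1 j)//= big1 ?addr0 ?eqxx; first by rewrite mul1r mulrBr.
    by move=> i /negbTE ->; rewrite !mul0r.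
  - by move=> k x; rewrite normr_sg; case: (_ != 0).
  - by move=> x; exact: cvg_sg_sin.
have -> : (fun x => (u < phi j x)%R%:R) =
    (fun x => (0 < f x)%R%:R) :> (T -> R).
  by apply/funext => x; rewrite /f sgr_gt0 subr_gt0.
exact: (bcl_gt0 trig_bounded trigM bcl_trig_one).
Qed.

End trig.

Lemma measurable_cos_comp {R : realType} {d} {T : measurableType d} (U : T -> R) :
  measurable_fun setT U -> measurable_fun setT (fun w => cos (U w)).
Proof.
by apply: measurableT_comp; apply: continuous_measurable_fun; exact: continuous_cos.
Qed.

Lemma integrable_scale {R : realType} {d} {W : measurableType d}
    (mu : {measure set W -> \bar R}) (a : R) (f : W -> R) :
  mu.-integrable setT (EFin \o f) ->
  mu.-integrable setT (EFin \o (fun w => a * f w)).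
Proof.
move=> fi; rewrite (_ : _ \o _ = (fun w => a%:E * (EFin \o f) w)%E).
  exact: integrableZl.
by apply/funext => w; rewrite /= EFinM.
Qed.

Section bounded_limits_integral.
Context {R : realType} {T : Type}.
Variable B : (T -> R) -> Prop.
Hypothesis bB : bounded_class B.

Lemma bcl_measurable {d} {W : measurableType d} (U : W -> T) :
  (forall f, B f -> measurable_fun setT (fun w => f (U w))) ->
  forall f, bcl B f -> measurable_fun setT (fun w => f (U w)).
Proof.
move=> mB f; elim=> [//|a g h _ mg _ mh|M f_ g _ mf_ _ f_g].
  by apply: measurable_funD => //; exact: measurable_funM.
by apply: (cvg_measurable mf_) => w; exact: f_g.
Qed.

Lemma bcl_integrable {d} {W : measurableType d} (P : probability W R) (U : W -> T) :
  (forall f, B f -> measurable_fun setT (fun w => f (U w))) ->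
  forall f, bcl B f -> P.-integrable setT (EFin \o (fun w => f (U w))).
Proof.
move=> mB f fB; apply: bounded_integrable; first exact: bcl_measurable.
by have [M fM] := bcl_bounded bB fB; exists M => w.
Qed.

Lemma bcl_Rintegral_eq {d d'} {W : measurableType d} {W' : measurableType d'}
    (P : probability W R) (Q : probability W' R) (U : W -> T) (V : W' -> T) :
  (forall f, B f -> measurable_fun setT (fun w => f (U w))) ->
  (forall f, B f -> measurable_fun setT (fun w => f (V w))) ->
  (forall f, B f -> \int[P]_w f (U w) = \int[Q]_w f (V w)) ->
  forall f, bcl B f -> \int[P]_w f (U w) = \int[Q]_w f (V w).
Proof.
move=> mU mV eB f; elim=> [//|a g h gB eg hB eh|M f_ g f_B ef_ f_M f_g].
  have gU := bcl_integrable P mU gB; have gV := bcl_integrable Q mV gB.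
  have hU := bcl_integrable P mU hB; have hV := bcl_integrable Q mV hB.
  rewrite !RintegralD//; try exact: integrable_scale.
  by rewrite !RintegralZl// eg eh.
have cU : \int[P]_w f_ n (U w) @[n --> \oo] --> \int[P]_w g (U w).
  apply: (@cvg_bounded_Rintegral _ _ _ P M (fun n w => f_ n (U w))) => //.
  by move=> n; exact: bcl_measurable.
have cV : \int[Q]_w f_ n (V w) @[n --> \oo] --> \int[Q]_w g (V w).
  apply: (@cvg_bounded_Rintegral _ _ _ Q M (fun n w => f_ n (V w))) => //.
  by move=> n; exact: bcl_measurable.
apply: (cvg_unique _ cU); first exact: norm_hausdorff.
by rewrite (_ : (fun n => _) = (fun n => \int[Q]_w f_ n (V w)))//; exact/funext.
Qed.

(** Independence of a fixed variable H extends from the generating class: with H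
    frozen, both sides are linear and continuous in f. *)
Lemma bcl_Rintegral_indep {d} {W : measurableType d} (P : probability W R)
    (U : W -> T) (H : W -> R) :
  measurable_fun setT H -> (exists M, forall w, `|H w| <= M) ->
  (forall f, B f -> measurable_fun setT (fun w => f (U w))) ->
  (forall f, B f ->
     \int[P]_w (f (U w) * H w) = \int[P]_w f (U w) * \int[P]_w H w) ->
  forall f, bcl B f ->
     \int[P]_w (f (U w) * H w) = \int[P]_w f (U w) * \int[P]_w H w.
Proof.
move=> mH [N HN] mU eB.
have mI f : bcl B f -> measurable_fun setT (fun w => f (U w) * H w).
  by move=> fB; apply: measurable_funM => //; exact: bcl_measurable.
have iI f : bcl B f -> P.-integrable setT (EFin \o (fun w => f (U w) * H w)).
  move=> fB; apply: bounded_integrable; first exact: mI.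
  have [M fM] := bcl_bounded bB fB.
  by exists (M * N) => w; rewrite normrM ler_pM.
move=> f; elim=> [//|a g h gB eg hB eh|M f_ g f_B ef_ f_M f_g].
  have gU := bcl_integrable P mU gB; have hU := bcl_integrable P mU hB.
  have gH := iI _ gB; have hH := iI _ hB.
  have -> : \int[P]_w ((a * g (U w) + h (U w)) * H w) =
            \int[P]_w (a * (g (U w) * H w) + h (U w) * H w).
    by apply: eq_Rintegral => w _; rewrite mulrDl mulrA.
  rewrite !RintegralD//; try exact: integrable_scale.
  by rewrite !RintegralZl// eg eh mulrDl mulrA.
have cU : \int[P]_w f_ n (U w) @[n --> \oo] --> \int[P]_w g (U w).
  apply: (@cvg_bounded_Rintegral _ _ _ P M (fun n w => f_ n (U w))) => //.
  by move=> n; exact: bcl_measurable.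
have cH : \int[P]_w (f_ n (U w) * H w) @[n --> \oo] --> \int[P]_w (g (U w) * H w).
  apply: (@cvg_bounded_Rintegral _ _ _ P (M * N) (fun n w => f_ n (U w) * H w)).
  - by move=> n; exact: mI.
  - by move=> n w; rewrite normrM ler_pM.
  - by move=> w; apply: cvgM => //; exact: cvg_cst.
apply: (cvg_unique _ cH); first exact: norm_hausdorff.
rewrite (_ : (fun n => _) = (fun n => \int[P]_w f_ n (U w) * \int[P]_w H w)).
  by apply: cvgM => //; exact: cvg_cst.
exact/funext.
Qed.

End bounded_limits_integral.

Section trig_law.
Context {R : realType}.

Lemma trig_measurable {d} {W : measurableType d} (T : Type) (n : nat)
    (phi : 'I_n -> T -> R) (U : W -> T) :
  (forall j, measurable_fun setT (fun w => phi j (U w))) ->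
  forall f, trig phi f -> measurable_fun setT (fun w => f (U w)).
Proof.
move=> mphi _ [a [c ->]]; apply: measurable_cos_comp.
apply: measurable_funD => //.
have ms j : measurable_fun setT (fun w => a j * phi j (U w)).
  exact: measurable_funM.
exact: (measurable_sum (index_enum _) ms).
Qed.

(** The finite-dimensional form of the uniqueness theorem for characteristic
    functions. *)
Lemma trig_determines_expectation {d d'} {W : measurableType d}
    {W' : measurableType d'} (P : probability W R) (Q : probability W' R)
    (n : nat) (U : W -> 'rV[R]_n) (V : W' -> 'rV[R]_n) :
  (forall j, measurable_fun setT (fun w => U w 0 j)) ->
  (forall j, measurable_fun setT (fun w => V w 0 j)) ->
  (forall a c, \int[P]_w cos (\sum_j a j * U w 0 j + c) =
               \int[Q]_w cos (\sum_j a j * V w 0 j + c)) ->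
  forall F : 'rV[R]_n -> R, continuous F -> (exists M, forall v, `|F v| <= M) ->
  [/\ measurable_fun setT (fun w => F (U w)),
      measurable_fun setT (fun w => F (V w)) &
      \int[P]_w F (U w) = \int[Q]_w F (V w)].
Proof.
move=> mU mV eUV F cF bF; pose phi (j : 'I_n) (v : 'rV[R]_n) := v 0 j.
have mtU := trig_measurable (phi := phi) (U := U) mU.
have mtV := trig_measurable (phi := phi) (U := V) mV.
have FB : bcl (trig phi) F.
  apply: (bcl_continuous (phi := id) (@trig_bounded _ _ _ phi)
    (@trigM _ _ _ phi) (@bcl_trig_one _ _ _ phi)) => // j u.
  exact: (bcl_trig_ray phi j u).
split; [exact: (bcl_measurable mtU FB)|exact: (bcl_measurable mtV FB)|].
apply: (bcl_Rintegral_eq (@trig_bounded _ _ _ phi)) => // _ [a [c ->]].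
exact: eUV.
Qed.

Definition trigR : (R -> R) -> Prop := trig (fun _ : 'I_1 => id).

Lemma trigR_cos (a c : R) : trigR (fun x => cos (a * x + c)).
Proof.
by exists (fun=> a), c; apply/funext => x; rewrite big_ord1.
Qed.

Lemma trigR_inv f : trigR f -> exists a c, f = fun x => cos (a * x + c).
Proof.
by move=> [a [c ->]]; exists (a 0), c; apply/funext => x; rewrite big_ord1.
Qed.

Lemma bcl_trig_indic (A : set R) : measurable A -> bcl trigR \1_A.
Proof.
move=> mA; apply: (bcl_indic (phi := id) (@trig_bounded _ _ _ _)
    (@trigM _ _ _ _) (@bcl_trig_one _ _ _ _)) => // u.
exact: (bcl_trig_ray (fun _ : 'I_1 => id) 0 u).
Qed.

Lemma Rintegral_indic {d} {W : measurableType d} (P : probability W R)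
    (U : W -> R) (A : set R) : measurable_fun setT U -> measurable A ->
  \int[P]_w \1_A (U w) = fine (P (U @^-1` A)).
Proof.
move=> mU mA; rewrite /Rintegral -[X in fine X = _]/(\int[P]_w (\1_(U @^-1` A) w)%:E)%E.
by rewrite integral_indic ?setIT// -[X in measurable X]setTI; exact: mU.
Qed.

Lemma trigR_measurable {d} {W : measurableType d} (U : W -> R) :
  measurable_fun setT U ->
  forall f, trigR f -> measurable_fun setT (fun w => f (U w)).
Proof. by move=> mU; exact: (trig_measurable (phi := fun _ : 'I_1 => id)). Qed.

(** Law of one variable: the indicator of a Borel set is a generated function. *)
Lemma trig_determines_law {d d'} {W : measurableType d} {W' : measurableType d'}
    (P : probability W R) (Q : probability W' R) (U : W -> R) (V : W' -> R) :
  measurable_fun setT U -> measurable_fun setT V ->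
  (forall a c, \int[P]_w cos (a * U w + c) = \int[Q]_w cos (a * V w + c)) ->
  forall A : set R, measurable A -> P (U @^-1` A) = Q (V @^-1` A).
Proof.
move=> mU mV eUV A mA.
have : \int[P]_w \1_A (U w) = \int[Q]_w \1_A (V w).
  apply: (bcl_Rintegral_eq (@trig_bounded _ _ _ (fun _ : 'I_1 => id))).
  - exact: trigR_measurable.
  - exact: trigR_measurable.
  - by move=> f /trigR_inv[a [c ->]]; exact: eUV.
  - exact: bcl_trig_indic.
rewrite !Rintegral_indic//.
have fU : P (U @^-1` A) \is a fin_num.
  by apply: fin_num_measure; rewrite -[X in measurable X]setTI; exact: mU.
have fV : Q (V @^-1` A) \is a fin_num.
  by apply: fin_num_measure; rewrite -[X in measurable X]setTI; exact: mV.
by move=> e; rewrite -(fineK fU) -(fineK fV) e.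
Qed.

(** The two variables are treated one after the other, the other one playing
    the part of a fixed weight. *)
Lemma trig_determines_indep {d} {W : measurableType d}
    (P : probability W R) (U V : W -> R) :
  measurable_fun setT U -> measurable_fun setT V ->
  (forall a b c e, \int[P]_w (cos (a * U w + c) * cos (b * V w + e)) =
     \int[P]_w cos (a * U w + c) * \int[P]_w cos (b * V w + e)) ->
  indep P U V.
Proof.
move=> mU mV eUV A C mA mC.
have bT := @trig_bounded R _ _ (fun _ : 'I_1 => id).
have mU1 := trigR_measurable mU; have mV1 := trigR_measurable mV.
have step b e : \int[P]_w (\1_A (U w) * cos (b * V w + e)) =
    \int[P]_w \1_A (U w) * \int[P]_w cos (b * V w + e).
  apply: (bcl_Rintegral_indep bT (B := trigR)) => //.
  - exact: (mV1 _ (trigR_cos b e)).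
  - by exists 1 => w; rewrite ler_norml cos_geN1 cos_le1.
  - by move=> f /trigR_inv[a [c ->]]; exact: eUV.
  - exact: bcl_trig_indic.
have : \int[P]_w (\1_C (V w) * \1_A (U w)) =
    \int[P]_w \1_C (V w) * \int[P]_w \1_A (U w).
  apply: (bcl_Rintegral_indep bT (B := trigR)) => //.
  - exact: (bcl_measurable mU1 (bcl_trig_indic mA)).
  - by exists 1 => w; rewrite indicE; case: (_ \in _); rewrite ?normr1 ?normr0.
  - move=> f /trigR_inv[b [e ->]].
    under eq_Rintegral do rewrite mulrC.
    by rewrite step mulrC.
  - exact: bcl_trig_indic.
have mUA : measurable (U @^-1` A) by rewrite -[X in measurable X]setTI; exact: mU.
have mVC : measurable (V @^-1` C) by rewrite -[X in measurable X]setTI; exact: mV.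
have -> : \int[P]_w (\1_C (V w) * \1_A (U w)) = fine (P (U @^-1` A `&` V @^-1` C)).
  rewrite /Rintegral; congr fine.
  rewrite -[in RHS](setIT (_ `&` _)) -integral_indic//; last exact: measurableI.
  by apply: eq_integral => w _; rewrite indicI /= mulrC.
rewrite !Rintegral_indic// mulrC => e.
rewrite -[LHS]fineK ?fin_num_measure//; last exact: measurableI.
by rewrite e EFinM !fineK ?fin_num_measure.
Qed.

End trig_law.

(** * Moments and characteristic function of the normal law *)

Section gaussian_density.
Context {R : realType}.
Variables (m s : R).
Hypothesis s0 : s != 0.
Local Notation mu := (@lebesgue_measure R).
Local Notation N := (normal_prob m s).
Local Notation phi := (normal_pdf m s).

(** The measure is defined as an integral of its density, so the density is a
    version of the Radon-Nikodym derivative. *)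
Lemma density_normal : ae_eq mu setT
  (Radon_Nikodym_SigmaFinite.f N mu) (EFin \o phi).
Proof.
have dom := normal_prob_dominates m s.
apply: integral_ae_eq => //.
- exact: Radon_Nikodym_SigmaFinite.f_integrable.
- by apply/measurable_EFinP; exact: measurable_normal_pdf.
- by move=> E _ mE; rewrite -Radon_Nikodym_SigmaFinite.f_integral.
Qed.

Lemma ge0_integral_normal_prob (f : R -> \bar R) :
  measurable_fun setT f -> (forall x, 0 <= f x)%E ->
  (\int[N]_x f x = \int[mu]_x (f x * (phi x)%:E))%E.
Proof.
move=> mf f0; have dom := normal_prob_dominates m s.
rewrite -(Radon_Nikodym_SigmaFinite.change_of_variables dom)//.
apply: ae_eq_integral => //.
- apply: emeasurable_funM => //; apply: (measurable_int mu).
  exact: Radon_Nikodym_SigmaFinite.f_integrable.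
- apply: emeasurable_funM => //.
  by apply/measurable_EFinP; exact: measurable_normal_pdf.
- by apply: ae_eqe_mul2l => /=; exact: density_normal.
Qed.

Lemma integrable_normal_prob (f : R -> R) : measurable_fun setT f ->
  mu.-integrable setT (EFin \o (fun x => f x * phi x)) <->
  N.-integrable setT (EFin \o f).
Proof.
move=> mf; have nf : (\int[N]_x `|(EFin \o f) x| =
    \int[mu]_x `|(EFin \o (fun x => f x * phi x)%R) x|)%E.
  rewrite ge0_integral_normal_prob//; last first.
    by apply: measurableT_comp => //; exact/measurable_EFinP.
  apply: eq_integral => x _ /=.
  by rewrite -EFinM normrM (ger0_norm (normal_pdf_ge0 _ _ _)).
split=> /integrableP[_ h]; apply/integrableP; split.
- exact/measurable_EFinP.
- by rewrite nf.
- apply/measurable_EFinP; apply: measurable_funM => //.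
  exact: measurable_normal_pdf.
- by rewrite -nf.
Qed.

Lemma Rintegral_normal_prob (f : R -> R) : N.-integrable setT (EFin \o f) ->
  \int[N]_x f x = \int[mu]_x (f x * phi x).
Proof.
move=> fi; have /measurable_EFinP mf := measurable_int _ fi.
have dom := normal_prob_dominates m s.
rewrite /Rintegral -(Radon_Nikodym_change_of_variables dom)//.
congr fine; under [RHS]eq_integral do rewrite EFinM.
apply: ae_eq_integral => //.
- apply: emeasurable_funM; first exact/measurable_EFinP.
  by apply: (measurable_int mu); exact: Radon_Nikodym_integrable.
- apply: emeasurable_funM; first exact/measurable_EFinP.
  by apply/measurable_EFinP; exact: measurable_normal_pdf.
- apply: ae_eqe_mul2l => /=; apply: ae_eq_trans density_normal.
  by apply: ae_eq_sym; exact: ae_eq_Radon_Nikodym_SigmaFinite.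
Qed.

(** Half of the Gaussian exponent absorbs the square, the other half is the
    density with the larger standard deviation. *)
Lemma integrable_sqr_normal :
  N.-integrable setT (EFin \o (fun x => (x - m) ^+ 2)).
Proof.
apply/integrable_normal_prob.
  by apply: measurable_funX => //; exact: measurable_funB.
pose r := Num.sqrt 2 * s; have r0 : r != 0 by rewrite mulf_neq0// sqrtr_eq0 -ltNge.
have r2 : r ^+ 2 = 2 * s ^+ 2 by rewrite exprMn sqr_sqrtr.
pose K := 4 * s ^+ 2 * normal_peak s / normal_peak r.
apply: (@le_integrable _ _ _ mu _ _ _ (EFin \o (fun x => K * normal_pdf m r x))) => //.
- apply/measurable_EFinP; apply: measurable_funM => //.
    by apply: measurable_funX => //; exact: measurable_funB.
  exact: measurable_normal_pdf.
- move=> x _ /=; rewrite lee_fin.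
  have p0 := normal_peak_gt0 r0; have q0 := normal_peak_gt0 s0.
  have s2 : 0 < s ^+ 2 by rewrite exprn_even_gt0.
  rewrite (ger0_norm (mulr_ge0 (sqr_ge0 _) (normal_pdf_ge0 _ _ _))).
  apply: le_trans (ler_norm _).
  rewrite !normal_pdfE//.
  have -> : K * (normal_peak r * normal_fun m r x) =
      normal_peak s * (4 * s ^+ 2 * normal_fun m r x).
    by rewrite /K; field; rewrite gt_eqF.
  rewrite mulrCA ler_wpM2l ?(ltW q0)//.
  rewrite /normal_fun r2; set y := (x - m) ^+ 2.
  pose u := y / (4 * s ^+ 2).
  have -> : - y / (s ^+ 2 *+ 2) = - u + - u by rewrite /u; field.
  have -> : - y / ((2 * s ^+ 2) *+ 2) = - u by rewrite /u; field.
  have -> : y = u * (4 * s ^+ 2) by rewrite /u; field.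
  have ue : u * expR (- u) <= 1.
    rewrite expRN ler_pdivrMr ?expR_gt0// mul1r.
    by rewrite (le_trans _ (expR_ge1Dx _))// lerDr.
  rewrite expRD; set e := expR _ in ue *.
  have -> : u * (4 * s ^+ 2) * (e * e) = 4 * s ^+ 2 * e * (u * e) by ring.
  have e0 : 0 <= e by exact: expR_ge0.
  by rewrite ler_piMr// mulr_ge0// mulr_ge0// sqr_ge0.
- apply: integrable_scale; exact: integrable_normal_pdf.
Qed.

Lemma integrable_affine_normal (A B : R) (f : R -> R) : measurable_fun setT f ->
  (forall x, `|f x| <= A + B * (x - m) ^+ 2) -> N.-integrable setT (EFin \o f).
Proof.
move=> mf fAB; have i1 : N.-integrable setT (EFin \o (fun=> A)).
  by apply: bounded_integrable => //; exists `|A|.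
have i2 := integrable_scale B integrable_sqr_normal.
apply: (@le_integrable _ _ _ N _ _ _ (EFin \o (fun x => A + B * (x - m) ^+ 2))) => //.
- exact/measurable_EFinP.
- move=> x _ /=; rewrite lee_fin (ger0_norm (le_trans _ (fAB x)))//.
- exact: (integrableD measurableT i1 i2).
Qed.

End gaussian_density.

Lemma is_derive_continuous {R : realType} (f f' : R -> R) :
  (forall x : R, is_derive x 1 f (f' x)) -> continuous f.
Proof.
move=> df x; apply: differentiable_continuous; apply/derivable1_diffP.
by have [] := df x.
Qed.

Lemma continuous_measurable {R : realType} (f : R -> R) :
  continuous f -> measurable_fun setT f.
Proof. exact: continuous_measurable_fun. Qed.

(** The fundamental theorem of calculus on symmetric intervals around m leaves
    only boundary terms, which vanish in the limit. *)
Lemma Rintegral_derive_vanishing {R : realType} (F h : R -> R) (m : R) :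
  (forall x : R, is_derive x 1 F (h x)) -> continuous h ->
  lebesgue_measure.-integrable setT (EFin \o h) ->
  F (m + k.+1%:R) - F (m - k.+1%:R) @[k --> \oo] --> (0 : R) ->
  \int[lebesgue_measure]_x h x = 0.
Proof.
move=> dF ch hi F0; set mu := lebesgue_measure.
pose I (k : nat) : set R := [set` `[m - k.+1%:R, m + k.+1%:R]].
have FTC k : \int[mu]_(x in I k) h x = F (m + k.+1%:R) - F (m - k.+1%:R).
  rewrite /Rintegral /I (@continuous_FTC2 _ h F)//.
  - by rewrite ltrD2l gtrN.
  - exact: continuous_subspaceT.
  - have cF := is_derive_continuous dF; split.
    + by move=> x _; have [] := dF x.
    + by apply: cvg_at_right_filter; exact: cF.
    + by apply: cvg_at_left_filter; exact: cF.
  - by move=> x _; rewrite derive1E; have [] := dF x.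
have cvgI : \int[mu]_(x in I k) h x @[k --> \oo] --> \int[mu]_x h x.
  under eq_fun do rewrite Rintegral_mkcond.
  apply: fine_cvg; rewrite fineK; last exact: integrable_fin_num.
  apply: (@dominated_cvg _ _ _ mu _ _ (fun k x => (h \_ (I k) x)%:E) _
      (fun x => `|(EFin \o h) x|%E)) => //.
  - move=> k; apply/measurable_EFinP; apply/measurable_restrict => //.
      exact: measurable_itv.
    by rewrite setTI; apply: measurable_funTS; exact: continuous_measurable.
  - move=> x _; apply: cvg_EFin; first exact: nearW.
    apply/cvg_ballP => e e0; near=> k.
    rewrite /= patchE mem_set; first exact: ballxx.
    rewrite /I /= in_itv /=.
    have xk : `|x - m| < k.+1%:R.
      near: k; exists (Num.truncn `|x - m|) => // k /= xk.
      have := truncnS_gt `|x - m| => /lt_le_trans; apply.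
      by rewrite ler_nat ltnS.
    by move: xk; rewrite ltr_norml => /andP[? ?]; lra.
  - exact: integrable_abse.
  - move=> k x _ /=; rewrite lee_fin patchE; case: ifP => // _.
    by rewrite normr0.
apply: (cvg_unique _ cvgI); first exact: norm_hausdorff.
by rewrite (_ : (fun k => _) =
  (fun k => F (m + k.+1%:R) - F (m - k.+1%:R)))//; exact/funext.
Unshelve. all: by end_near. Qed.

Section stein.
Context {R : realType}.
Variables (m s : R).
Hypothesis s0 : s != 0.
Local Notation mu := (@lebesgue_measure R).
Local Notation N := (normal_prob m s).
Local Notation phi := (normal_pdf m s).

Lemma is_derive_normal_pdf (x : R) :
  is_derive x 1 phi (- ((x - m) / s ^+ 2) * phi x).
Proof.
rewrite normal_pdfE//.
have df : is_derive x 1 (fun x => - (x - m) ^+ 2 / (s ^+ 2 *+ 2))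
    (- ((x - m) / s ^+ 2)).
  apply: is_derive_eq; rewrite /GRing.scale /=; field.
  exact: s0.
have := is_deriveZ (normal_peak s) (is_derive1_comp (is_derive_expR _) df).
move=> d; apply: (is_derive_eq d).
by rewrite /GRing.scale /= /normal_fun; ring.
Qed.

(** The bound expR u >= u for the Gaussian exponent; quadratic decay is enough to
    kill boundary terms of linear growth. *)
Lemma normal_pdf_decay (n : R) : 0 < n ->
  phi (m + n) <= normal_peak s * (2 * s ^+ 2) / n ^+ 2 /\
  phi (m - n) <= normal_peak s * (2 * s ^+ 2) / n ^+ 2.
Proof.
move=> n0; rewrite !normal_pdfE// /normal_fun.
have -> : - (m + n - m) ^+ 2 / (s ^+ 2 *+ 2) = - (n ^+ 2 / (2 * s ^+ 2)).
  by field.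
have -> : - (m - n - m) ^+ 2 / (s ^+ 2 *+ 2) = - (n ^+ 2 / (2 * s ^+ 2)).
  by field.
have s2 : 0 < s ^+ 2 by rewrite exprn_even_gt0.
suff : normal_peak s * expR (- (n ^+ 2 / (2 * s ^+ 2))) <=
    normal_peak s * (2 * s ^+ 2) / n ^+ 2 by [].
rewrite -mulrA ler_wpM2l ?normal_peak_ge0// expRN.
have -> : 2 * s ^+ 2 / n ^+ 2 = (n ^+ 2 / (2 * s ^+ 2))^-1 by rewrite invf_div.
have u0 : 0 < n ^+ 2 / (2 * s ^+ 2) by rewrite divr_gt0// ?exprn_gt0// mulr_gt0.
rewrite lef_pV2 ?posrE ?expR_gt0//.
by rewrite (le_trans _ (expR_ge1Dx _))// lerDr.
Qed.

(** Integrating the derivative of f times the density over the line yields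
    zero; the derivative of the density is the density times an affine
    function. *)
Lemma stein_identity (A B : R) (f f' : R -> R) :
  (forall x : R, is_derive x 1 f (f' x)) -> continuous f' ->
  0 <= A -> 0 <= B ->
  (forall x, `|f x| <= A + B * `|x - m|) -> (forall x, `|f' x| <= B) ->
  \int[N]_x ((x - m) * f x) = s ^+ 2 * \int[N]_x f' x.
Proof.
move=> df cf' A0 B0 fAB f'B.
have cf := is_derive_continuous df.
have s2 : 0 < s ^+ 2 by rewrite exprn_even_gt0.
have le1 (x : R) : `|x - m| <= 1 + (x - m) ^+ 2.
  rewrite -real_normK ?num_real//; set y := `|_|.
  by have := sqr_ge0 (y - 2^-1); rewrite sqrrB; lra.
have mf : measurable_fun setT (fun x : R => (x - m) * f x).
  apply: measurable_funM; last exact: continuous_measurable.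
  exact: measurable_funB.
have i1 : N.-integrable setT (EFin \o (fun x => (x - m) * f x)).
  apply: (@integrable_affine_normal _ m s s0 A (A + B)) => // x.
  rewrite normrM (le_trans (ler_wpM2l _ (fAB x)))//.
  rewrite mulrDr mulrCA -expr2 real_normK ?num_real// mulrDl addrA lerD2r.
  by have := ler_wpM2r A0 (le1 x); lra.
have i2 : N.-integrable setT (EFin \o f').
  apply: bounded_integrable; last by exists B.
  exact: continuous_measurable.
pose k x := f' x + - (s ^+ 2)^-1 * ((x - m) * f x).
have i1s := integrable_scale (- (s ^+ 2)^-1) i1.
have ik : N.-integrable setT (EFin \o k).
  exact: (integrableD measurableT i2 i1s).
suff : \int[N]_x k x = 0.
  rewrite RintegralD// RintegralZl// mulNr => /eqP; rewrite subr_eq0 => /eqP ->.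
  by rewrite mulrA divff ?mul1r// gt_eqF.
rewrite Rintegral_normal_prob//.
apply: (@Rintegral_derive_vanishing _ (fun x => f x * phi x) _ m).
- move=> x; have := is_deriveM (df x) (is_derive_normal_pdf x).
  move=> d; apply: (is_derive_eq d).
  by rewrite /GRing.scale /= /k; field.
- move=> x; apply: cvgM; last exact: continuous_normal_pdf.
  apply: cvgD; first exact: cf'.
  apply: cvgM; first exact: cvg_cst.
  apply: cvgM; last exact: cf.
  by apply: cvgB; [exact: cvg_id|exact: cvg_cst].
- apply/integrable_normal_prob => //.
  by have /measurable_EFinP := measurable_int _ ik.
- pose C := (A + B) * (normal_peak s * (2 * s ^+ 2)).
  have bd n (x : R) : 1 <= n -> x = m + n \/ x = m - n ->
      `|f x * phi x| <= C / n.
    move=> n1 xn; have n0 : 0 < n by exact: lt_le_trans n1.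
    have phin : phi x <= normal_peak s * (2 * s ^+ 2) / n ^+ 2.
      by have [] := normal_pdf_decay n0; case: xn => ->.
    have xm : `|x - m| = n.
      by case: xn => ->; rewrite [m + _]addrC ?addrK ?normrN gtr0_norm.
    rewrite normrM (ger0_norm (normal_pdf_ge0 _ _ _)).
    have fn : `|f x| <= (A + B) * n.
      rewrite (le_trans (fAB x))// xm mulrDl lerD2r.
      by rewrite ler_peMr.
    rewrite (le_trans (ler_pM _ _ fn phin)) ?normal_pdf_ge0//.
    rewrite le_eqVlt; apply/orP; left; apply/eqP.
    by rewrite /C; field; rewrite gt_eqF.
  apply: norm_cvg0; apply: (@squeeze_cvgr _ _ _ _ (fun=> 0)
      (fun k => 2 * C * k.+1%:R^-1)).
  + apply: nearW => n; rewrite normr_ge0 /=.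
    rewrite (le_trans (ler_normB _ _))//.
    have n1 : 1 <= n.+1%:R :> R by rewrite ler1n.
    have b1 := bd _ _ n1 (or_introl erefl); have b2 := bd _ _ n1 (or_intror erefl).
    by rewrite -mulrA mulr_natl mulr2n lerD.
  + exact: cvg_cst.
  + rewrite -[X in _ --> X](mulr0 (2 * C)); apply: cvgM; first exact: cvg_cst.
    exact: cvg_harmonic.
Qed.

End stein.

Section normal_characteristic_function.
Context {R : realType}.
Variables (m s : R).
Hypothesis s0 : s != 0.
Local Notation N := (normal_prob m s).

Let Rintegral_normal_cst (r : R) : \int[N]_x r = r.
Proof.
rewrite Rintegral_cst// [X in fine X](_ : _ = 1%E) ?mulr1//.
exact: probability_setT.
Qed.

Lemma integrable_normal_id : N.-integrable setT (EFin \o id).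
Proof.
apply: (@integrable_affine_normal _ m s s0 (1 + `|m|) 1) => // x.
have : `|x| <= `|x - m| + `|m| by rewrite -{1}[x](subrK m) ler_normD.
have : `|x - m| <= 1 + (x - m) ^+ 2.
  rewrite -real_normK ?num_real//; set y := `|_|.
  by have := sqr_ge0 (y - 2^-1); rewrite sqrrB; lra.
by rewrite mul1r; lra.
Qed.

Lemma normal_mean : \int[N]_x x = m.
Proof.
have := @stein_identity _ m s s0 1 0 (fun=> 1) (fun=> 0).
have d x : is_derive (x : R) 1 (fun=> 1 : R) (0 : R) by exact: is_derive_cst.
move=> /(_ d (@cst_continuous _ _ _) ler01 (lexx _)).
have -> : \int[N]_x ((x - m) * 1) = \int[N]_x x - m.
  under eq_Rintegral do rewrite mulr1.
  have im : N.-integrable setT (EFin \o (fun=> m)).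
    by apply: bounded_integrable => //; exists `|m|.
  by rewrite (RintegralB measurableT integrable_normal_id im) Rintegral_normal_cst.
rewrite Rintegral_normal_cst mulr0 => h; apply/eqP; rewrite -subr_eq0; apply/eqP.
by apply: h => x; rewrite ?normr1 ?mul0r ?addr0 ?normr0.
Qed.

Lemma normal_variance : \int[N]_x (x - m) ^+ 2 = s ^+ 2.
Proof.
have := @stein_identity _ m s s0 0 1 (fun x => x - m) (fun=> 1).
have d x : is_derive (x : R) 1 (fun x : R => x - m) (1 : R).
  by apply: is_derive_eq; rewrite subr0.
move=> /(_ d (@cst_continuous _ _ _) (lexx _) ler01).
rewrite Rintegral_normal_cst mulr1 => h.
by apply: h => x; rewrite ?add0r ?mul1r ?normr1.
Qed.

Let C (c t : R) := \int[N]_x cos (t * (x - m) + c).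

(** Differentiating under the integral brings down a factor x - m, which
    Stein's identity trades for a derivative of the sine. *)
Lemma is_derive_cos_normal (c t : R) : is_derive t 1 (C c) (- (s ^+ 2 * t) * C c t).
Proof.
pose f (t x : R) := cos (t * (x - m) + c).
have df (x u : R) : is_derive u 1 (f ^~ x) (- sin (u * (x - m) + c) * (x - m)).
  have dl : is_derive u 1 (fun u => u * (x - m) + c) (x - m).
    by apply: is_derive_eq; rewrite /GRing.scale /= !(mulr0, mul1r, mulr1, addr0, add0r).
  have := is_derive1_comp (is_derive_cos _) dl; exact.
have d1f u x : partial1of2 f u x = - sin (u * (x - m) + c) * (x - m).
  by rewrite partial1of2E; have [] := df x u.
have mlin u : measurable_fun setT (fun x : R => u * (x - m) + c).
  by apply: measurable_funD => //; apply: measurable_funM => //; exact: measurable_funB.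
have intf u : N.-integrable setT (EFin \o f u).
  apply: bounded_integrable; first exact: (measurable_cos_comp (mlin u)).
  by exists 1 => x; rewrite ler_norml cos_geN1 cos_le1.
have intG : N.-integrable setT (EFin \o (fun x => `|x - m|)).
  apply: (@integrable_affine_normal _ m s s0 1 1) => [|x].
    by apply: measurableT_comp => //; exact: measurable_funB.
  rewrite normr_id mul1r -real_normK ?num_real//; set y := `|_|.
  by have := sqr_ge0 (y - 2^-1); rewrite sqrrB; lra.
have Gub u x : `|partial1of2 f u x| <= `|x - m|.
  rewrite d1f normrM normrN ler_piMl//.
  by rewrite ler_norml sin_geN1 sin_le1.
have It : [set` `]t - 1, t + 1[] t by rewrite /= in_itv /=; apply/andP; split; lra.
have dif u x : derivable (f ^~ x) u 1 by have [] := df x u.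
have cC := @derivable_under_integral _ _ _ N f setT measurableT t (t - 1) (t + 1)
  It (fun u _ => intf u) (fun u x _ _ => dif u x) (fun x => `|x - m|)
  (fun x => normr_ge0 _) intG (fun u x _ _ => Gub u x).
have eC := @differentiation_under_integral _ _ _ N f setT measurableT t (t - 1) (t + 1)
  It (fun u _ => intf u) (fun u x _ _ => dif u x) (fun x => `|x - m|)
  (fun x => normr_ge0 _) intG (fun u x _ _ => Gub u x).
apply: DeriveDef => //; rewrite -derive1E eC.
have dsin x : is_derive (x : R) 1 (fun x : R => sin (t * (x - m) + c))
    (t * cos (t * (x - m) + c)).
  have dl : is_derive x 1 (fun x => t * (x - m) + c) t.
    by apply: is_derive_eq; rewrite /GRing.scale /= !(mulr0, mul1r, mulr1, addr0, add0r, subr0).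
  have := is_derive1_comp (is_derive_sin _) dl.
  by move=> d; apply: (is_derive_eq d); rewrite mulrC.
have cc : continuous (fun x : R => t * cos (t * (x - m) + c)).
  move=> x; apply: cvgM; first exact: cvg_cst.
  apply: (cvg_comp (fun x => t * (x - m) + c)); last exact: continuous_cos.
  apply: cvgD; last exact: cvg_cst.
  apply: cvgM; first exact: cvg_cst.
  by apply: cvgB; [exact: cvg_id|exact: cvg_cst].
have := @stein_identity _ m s s0 1 `|t| _ _ dsin cc ler01 (normr_ge0 _).
move=> st.
transitivity (- \int[N]_x ((x - m) * sin (t * (x - m) + c))).
  rewrite -[RHS]mulN1r -RintegralZl//.
    by apply: eq_Rintegral => x _; rewrite d1f; ring.
  apply: (@integrable_affine_normal _ m s s0 1 1) => [|x].
    apply: measurable_funM; first exact: measurable_funB.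
    by apply: measurableT_comp => //; apply: continuous_measurable; exact: continuous_sin.
  rewrite normrM mul1r -real_normK ?num_real//; set y := `|x - m|.
  have : y * `|sin (t * (x - m) + c)| <= y.
    by rewrite ler_piMr ?normr_ge0// ler_norml sin_geN1 sin_le1.
  by have := sqr_ge0 (y - 2^-1); rewrite sqrrB; lra.
rewrite st.
- rewrite RintegralZl; [|by []|exact: intf].
  by rewrite /C; ring.
- move=> x; rewrite (@le_trans _ _ 1)//; last by rewrite lerDl mulr_ge0.
  by rewrite ler_norml sin_geN1 sin_le1.
- by move=> x; rewrite normrM ler_piMr// ler_norml cos_geN1 cos_le1.
Qed.

(** The quotient of both sides has derivative zero in t, by the differential
    equation above. *)
Lemma cos_normal (c t : R) :
  \int[N]_x cos (t * (x - m) + c) = expR (- (s ^+ 2 * t ^+ 2 / 2)) * cos c.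
Proof.
pose D (t : R) := C c t * expR (s ^+ 2 * t ^+ 2 / 2).
have dD (u : R) : is_derive u 1 D 0.
  have de : is_derive u 1 (fun t : R => s ^+ 2 * t ^+ 2 / 2) (s ^+ 2 * u).
    by apply: is_derive_eq; rewrite /GRing.scale /=; field.
  have := is_deriveM (is_derive_cos_normal c u) (is_derive1_comp (is_derive_expR _) de).
  move=> d; apply: (is_derive_eq d); rewrite /GRing.scale /=; ring.
have := is_derive_0_is_cst t 0 dD; rewrite /D.
rewrite expr0n /= mulr0 mul0r expR0 mulr1 => e.
have -> : \int[N]_x cos (t * (x - m) + c) = C c t by [].
rewrite expRN mulrC; apply/eqP; rewrite eq_sym -[X in X == _]mulrC; apply/eqP.
have <- : C c 0 = cos c.
  rewrite /C; under eq_Rintegral do rewrite mul0r add0r.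
  by rewrite Rintegral_normal_cst.
by rewrite -e; field; rewrite gt_eqF ?expR_gt0.
Qed.

End normal_characteristic_function.

Section gaussian_random_variable.
Context {R : realType} {d : measure_display} {T : measurableType d}.
Variable P : probability T R.
Implicit Types X : T -> R.

Lemma Rintegral_law X (nu : {measure set (measurableTypeR R) -> \bar R}) (h : R -> R) :
  measurable_fun setT X ->
  (forall B : set R, measurable B -> P (X @^-1` B) = nu B) ->
  measurable_fun setT h -> P.-integrable setT (EFin \o (fun w => h (X w))) ->
  \int[P]_w h (X w) = \int[nu]_x h x.
Proof.
move=> mX XB mh hi; rewrite /Rintegral; congr fine.
have mX' : X \in @mfun _ _ T (measurableTypeR R) by exact: mem_set.
pose Y : {RV P >-> measurableTypeR R} :=
  @mfun_Sub _ _ T (measurableTypeR R) X mX'.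
rewrite -(@eq_measure_integral _ _ _ setT nu (distribution P Y)) => [|A mA _].
  by rewrite integral_distribution//; exact/measurable_EFinP.
exact: XB.
Qed.

(** The parameters of the law are unknown, but are identified by the first two
    moments. *)
Lemma gaussian_cos X (v : R) : gaussian_rv P X ->
  P.-integrable setT (EFin \o X) ->
  P.-integrable setT (EFin \o (fun w => X w ^+ 2)) ->
  \int[P]_w X w = 0 -> \int[P]_w X w ^+ 2 = v ->
  forall c, \int[P]_w cos (X w + c) = expR (- (v / 2)) * cos c.
Proof.
move=> [mX [m [s XB]]] iX iX2 EX EX2 c.
have mid : measurable_fun setT (id : R -> R) by [].
have msq : measurable_fun setT (fun x : R => x ^+ 2) by exact: measurable_funX.
have mcos : measurable_fun setT (fun x : R => cos (x + c)).
  by apply: measurable_cos_comp; exact: measurable_funD.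
have icos : P.-integrable setT (EFin \o (fun w => cos (X w + c))).
  apply: bounded_integrable; first exact: (measurableT_comp mcos).
  by exists 1 => x; rewrite ler_norml cos_geN1 cos_le1.
have [s0|s0] := eqVneq s 0.
  pose nu : {measure set (measurableTypeR R) -> \bar R} :=
    @dirac _ (measurableTypeR R) m R.
  have XB' (B : set R) : measurable B -> P (X @^-1` B) = nu B.
    by move=> mB; rewrite XB// /normal_law s0 eqxx.
  have diracE (h : R -> R) : measurable_fun setT h -> \int[nu]_x h x = h m.
    move=> mh; rewrite /Rintegral (@integral_dirac _ (measurableTypeR R))//; last exact/measurable_EFinP.
    by rewrite diracT mul1e.
  rewrite (Rintegral_law mX XB' mcos icos) diracE//.
  have := Rintegral_law mX XB' mid iX; rewrite diracE// EX => m0.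
  have := Rintegral_law mX XB' msq iX2; rewrite diracE// EX2 -m0 expr0n /= => ->.
  by rewrite mul0r oppr0 expR0 mul1r add0r.
have XB' (B : set R) : measurable B -> P (X @^-1` B) = normal_prob m s B.
  by move=> mB; rewrite XB// /normal_law (negbTE s0).
have m0 : m = 0.
  by rewrite -(normal_mean m s0) -(Rintegral_law mX XB' mid iX).
subst m; have := Rintegral_law mX XB' msq iX2.
have -> : \int[normal_prob 0 s]_x x ^+ 2 = s ^+ 2.
  by rewrite -(normal_variance 0 s0); apply: eq_Rintegral => x _; rewrite subr0.
rewrite EX2 (Rintegral_law mX XB' mcos icos) => ->.
have := cos_normal 0 s0 c 1; rewrite expr1n mulr1 => <-.
by apply: eq_Rintegral => x _; rewrite subr0 mul1r.
Qed.

End gaussian_random_variable.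

(** * Independent standard normal variables *)

Section indicator_functions.
Context {R : realType} {d : measure_display} {T : measurableType d}.

Definition indicators (f : T -> R) : Prop := exists2 A : set T, measurable A & f = \1_A.

Lemma indicators_bounded : bounded_class indicators.
Proof.
by move=> _ [A _ ->]; exists 1 => x; rewrite indicE; case: (_ \in _);
  rewrite ?normr1 ?normr0.
Qed.

Lemma indicatorsM f g : indicators f -> indicators g -> bcl indicators (fun x => f x * g x).
Proof.
move=> [A mA ->] [B mB ->]; apply: bcl_base; exists (A `&` B).
  exact: measurableI.
by apply/funext => x; rewrite indicI.
Qed.

Lemma indicators_one : indicators (fun=> 1).
Proof. by exists setT => //; apply/funext => x; rewrite indicT. Qed.

Lemma indicators_measurable {d'} {W : measurableType d'} (U : W -> T) :
  measurable_fun setT U ->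
  forall f, indicators f -> measurable_fun setT (fun w => f (U w)).
Proof.
by move=> mU _ [A mA ->]; exact: (measurableT_comp (measurable_indic mA)).
Qed.

End indicator_functions.

Lemma bcl_indicators_cos {R : realType} (a c : R) :
  bcl indicators (fun x : R => cos (a * x + c)).
Proof.
pose F (v : 'rV[R]_1) := cos (a * v 0 0 + c).
have -> : (fun x => cos (a * x + c)) = (fun x => F (\row_(j < 1) x)).
  by apply/funext => x; rewrite /F mxE.
apply: (bcl_continuous (phi := fun x => \row_(j < 1) x) (F := F)
  indicators_bounded indicatorsM (bcl_base indicators_one)).
- move=> j u; apply: bcl_base; exists [set` `]u, +oo[]; first exact: measurable_itv.
  by apply/funext => x; rewrite indicE mem_setE in_itv /= andbT mxE.
- have cl : continuous (fun v : 'rV[R]_1 => a * v 0 0 + c).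
    move=> v; have h : (fun w : 'rV[R]_1 => w 0 0) @ v --> v 0 0.
      exact: coord_continuous.
    exact: (cvgD (cvgM (cvg_cst a) h) (cvg_cst c)).
  by move=> v; apply: continuous_comp; [exact: cl|exact: continuous_cos].
- by exists 1 => v; rewrite ler_norml cos_geN1 cos_le1.
Qed.

Section independence_product.
Context {R : realType} {d : measure_display} {T : measurableType d}.
Variables (P : probability T R) (I : choiceType) (G : I -> {RV P >-> R}).
Hypothesis iG : mutual_indep P (fun i => G i : T -> R).

Let mG i : measurable_fun setT (G i : T -> R). Proof. by []. Qed.

Lemma indep_prod_indic (r : seq I) (A : I -> set R) : uniq r ->
  (forall i, measurable (A i)) ->
  \int[P]_w (\prod_(i <- r) \1_(A i) (G i w)) =
  \prod_(i <- r) \int[P]_w \1_(A i) (G i w).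
Proof.
move=> ur mA; pose J := [fset i | i in r]%fset.
have Jr : perm_eq J r.
  by apply: uniq_perm => // i; rewrite !inE.
have mGA i : measurable (G i @^-1` A i).
  by rewrite -[X in measurable X]setTI; exact: mG.
have mJ : measurable (\bigcap_(i in [set` J]) (G i @^-1` A i)).
  exact: fin_bigcap_measurable.
have := iG J mA; rewrite (perm_big _ Jr) /= => PJ.
have -> : \int[P]_w (\prod_(i <- r) \1_(A i) (G i w)) =
    fine (P (\bigcap_(i in [set` J]) (G i @^-1` A i))).
  rewrite /Rintegral; congr fine.
  rewrite -[in RHS](setIT (\bigcap_(_ in _) _)) -integral_indic//.
  apply: eq_integral => w _; congr EFin.
  rewrite [RHS]indicE; have [wJ|wJ] := boolP (_ \in _).
    rewrite big_seq big1// => i ir; rewrite indicE mem_set//.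
    by move/set_mem : wJ => /(_ i); apply; rewrite /J /= !inE.
  have [i ir wi] : exists2 i, i \in r & ~ A i (G i w).
    apply: contrapT => h; move/negP : wJ; apply; apply/mem_set => i /=.
    rewrite /J !inE => ir; apply: contrapT => wi.
    by apply: h; exists i.
  by rewrite (big_rem i)//= indicE memNset// mul0r.
rewrite PJ (_ : \prod_(i <- r) P _ =
    \prod_(i <- r) (\int[P]_w \1_(A i) (G i w))%:E)%E.
  by rewrite prodEFin.
apply: eq_bigr => i _; rewrite Rintegral_indic// fineK//.
exact: fin_num_measure.
Qed.

Definition update (f : I -> R -> R) (a : I) (h : R -> R) (i : I) : R -> R :=
  if i == a then h else f i.

Lemma measurable_prod_comp (r : seq I) (f : I -> R -> R) :
  (forall i, measurable_fun setT (fun w => f i (G i w))) ->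
  measurable_fun setT (fun w => \prod_(i <- r) f i (G i w)).
Proof.
move=> mf; elim: r => [|i r ih].
  rewrite (_ : (fun w => _) = (fun=> 1)); first exact: measurable_cst.
  by apply/funext => w; rewrite big_nil.
rewrite (_ : (fun w => _) =
    (fun w => f i (G i w) * \prod_(i <- r) f i (G i w))).
  exact: measurable_funM.
by apply/funext => w; rewrite big_cons.
Qed.

Let mB i : forall f : R -> R, bcl indicators f ->
  measurable_fun setT (fun w => f (G i w)).
Proof. by apply: bcl_measurable; exact: indicators_measurable. Qed.

Lemma bounded_prod (r : seq I) (f : I -> R -> R) :
  (forall i, exists M, forall x, `|f i x| <= M) ->
  exists M, forall w, `|\prod_(i <- r) f i (G i w)| <= M.
Proof.
move=> bf; elim: r => [|i r [M hM]].
  by exists 1 => w; rewrite big_nil normr1.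
have [N hN] := bf i; exists (N * M) => w.
by rewrite big_cons normrM ler_pM.
Qed.

(** Indicators are replaced by general functions one variable at a time, the
    product over the other variables acting as a fixed weight. *)
Lemma indep_prod (r : seq I) (f : I -> R -> R) : uniq r ->
  (forall i, bcl indicators (f i)) ->
  \int[P]_w (\prod_(i <- r) f i (G i w)) =
  \prod_(i <- r) \int[P]_w f i (G i w).
Proof.
(* outside s the functions are still indicators *)
suff main (s : seq I) : forall r f, uniq r -> (forall i, bcl indicators (f i)) ->
    (forall i, i \in r -> i \notin s -> indicators (f i)) ->
    \int[P]_w (\prod_(i <- r) f i (G i w)) =
    \prod_(i <- r) \int[P]_w f i (G i w).
  by move=> ur fB; apply: (main r) => // i ->.
elim: s => [|a s ih] {}r {}f ur fB fI.
  have /choice[A hA] : forall i, exists A : set R,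
      measurable A /\ (i \in r -> f i = \1_A).
    move=> i; have [ir|ir] := boolP (i \in r).
      by have [//|A mA fA] := fI i ir; exists A.
    by exists setT; split.
  have := @indep_prod_indic r A ur (fun i => (hA i).1).
  rewrite (eq_big_seq (fun i => \int[P]_w f i (G i w))) => [<-|i ir].
    apply: eq_Rintegral => w _; apply: eq_big_seq => i ir.
    by rewrite (hA i).2.
  by rewrite (hA i).2.
have [ar|ar] := boolP (a \in r); last first.
  apply: ih => // i ir nis; apply: fI => //; rewrite inE negb_or nis andbT.
  by apply: contraNneq ar => <-.
pose r' := rem a r.
have ur' : uniq r' by rewrite rem_uniq.
have ar' : a \notin r' by rewrite mem_rem_uniqF.
have r'r i : i \in r' -> i \in r by exact: mem_rem.
pose H w := \prod_(i <- r') f i (G i w).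
have fH : \int[P]_w H w = \prod_(i <- r') \int[P]_w f i (G i w).
  apply: ih => // i ir nis; apply: fI; first exact: r'r.
  by rewrite inE negb_or nis andbT; apply: contraNneq ar' => <-.
have mH : measurable_fun setT H.
  by apply: measurable_prod_comp => i; exact: mB.
have bH : exists M, forall w, `|H w| <= M.
  by apply: bounded_prod => i; exact: bcl_bounded indicators_bounded _ (fB i).
have step h : indicators h -> \int[P]_w (h (G a w) * H w) =
    \int[P]_w h (G a w) * \int[P]_w H w.
  move=> hI; have := ih r (update f a h) ur.
  rewrite /update; have updB i : bcl indicators (if i == a then h else f i).
    by case: ifP => // _; exact: bcl_base.
  move=> /(_ updB) e.
  have {}e : \int[P]_w (h (G a w) * H w) =
      \prod_(i <- r) \int[P]_w (if i == a then h else f i) (G i w).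
    rewrite -e => [|i ir nis].
      apply: eq_Rintegral => w _; rewrite (big_rem a)//= eqxx; congr (_ * _).
      by apply: eq_big_seq => i ir'; case: eqP => // ia; rewrite -ia ir' in ar'.
    by case: eqP => // /eqP ia; apply: fI => //; rewrite inE negb_or ia.
  rewrite e (big_rem a)//= eqxx fH; congr (_ * _).
  by apply: eq_big_seq => i ir'; case: eqP => // ia; rewrite -ia ir' in ar'.
rewrite [RHS](big_rem a)//= -/r' -fH.
under eq_Rintegral do rewrite (big_rem a)//= -/r'.
apply: (bcl_Rintegral_indep indicators_bounded (U := G a) (H := H)) => //.
by move=> g gI; apply: mB; exact: bcl_base.
Qed.

End independence_product.

Section iid_normal.
Context {R : realType} {d : measure_display} {T : measurableType d}.
Variables (P : probability T R) (I : choiceType) (G : I -> {RV P >-> R}).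
Hypothesis hG : iid_standard_normal G.

Lemma standard_normal_cos i (a c : R) :
  \int[P]_w cos (a * G i w + c) = expR (- (a ^+ 2 / 2)) * cos c.
Proof.
have [lG _] := hG; have s0 : (1 : R) != 0 by exact: oner_neq0.
have mc : measurable_fun setT (fun x : R => cos (a * x + c)).
  by apply: measurable_cos_comp; apply: measurable_funD => //; exact: measurable_funM.
have mGi : measurable_fun setT (G i : T -> R) by [].
rewrite (@Rintegral_law _ _ _ P (G i) (normal_prob 0 1) _ mGi (lG i) mc).
  have := cos_normal 0 s0 c a; rewrite expr1n mul1r => <-.
  by apply: eq_Rintegral => x _; rewrite subr0.
apply: bounded_integrable; first exact: (measurableT_comp mc).
by exists 1 => x; rewrite ler_norml cos_geN1 cos_le1.
Qed.

(** Expanding one summand of the phase by the addition formula turns it into a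
    factor of the product; the sine part integrates to zero by symmetry. *)
Lemma iid_normal_cos_prod (s r : seq I) (a : I -> R) (f : I -> R -> R) (c : R) :
  uniq (s ++ r) -> (forall i, bcl indicators (f i)) ->
  \int[P]_w (cos (\sum_(i <- s) a i * G i w + c) * \prod_(i <- r) f i (G i w)) =
  expR (- ((\sum_(i <- s) a i ^+ 2) / 2)) * cos c *
    \prod_(i <- r) \int[P]_w f i (G i w).
Proof.
have [_ iG] := hG.
have mGi i : measurable_fun setT (G i : T -> R) by [].
have mB i : forall f : R -> R, bcl indicators f -> measurable_fun setT (fun w => f (G i w)).
  by apply: bcl_measurable; exact: indicators_measurable.
have int u v g (e : R) : (forall i, bcl indicators (g i)) -> P.-integrable setT
    (EFin \o (fun w => cos (\sum_(i <- u) a i * G i w + e) *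
                       \prod_(i <- v) g i (G i w))).
  move=> gB; apply: bounded_integrable.
    apply: measurable_funM; last first.
      by apply: measurable_prod_comp => i; exact: mB.
    apply: measurable_cos_comp; apply: measurable_funD => //.
    have ms i : measurable_fun setT (fun w => a i * G i w) by exact: measurable_funM.
    exact: (measurable_sum u ms).
  have [|M hM] := @bounded_prod _ _ _ P _ G v g.
    by move=> i; exact: bcl_bounded indicators_bounded _ (gB i).
  exists (1 * M) => w; rewrite normrM ler_pM//.
  by rewrite ler_norml cos_geN1 cos_le1.
elim: s r f c => [|x s ih] r f c ur fB.
  rewrite big_nil mul0r oppr0 expR0 mul1r -(indep_prod iG)// -RintegralZl//.
    by apply: eq_Rintegral => w _; rewrite big_nil add0r.
  have := int [::] r f 0 fB; congr (_.-integrable _ _).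
  by apply/funext => w; rewrite /= big_nil add0r cos0 mul1r.
move: ur; rewrite cat_cons cons_uniq => /andP[xsr usr].
have [xs xr] : x \notin s /\ x \notin r.
  by move: xsr; rewrite mem_cat negb_or => /andP[].
have uxr : uniq (s ++ x :: r).
  move: usr; rewrite !cat_uniq /= => /and3P[-> ns ->].
  by rewrite negb_or xs ns xr.
pose h e y := cos (a x * y + e); pose g e := update f x (h e).
have gB e i : bcl indicators (g e i).
  by rewrite /g /update; case: ifP => // _; exact: bcl_indicators_cos.
have gprod e w : \prod_(i <- x :: r) g e i (G i w) =
    cos (a x * G x w + e) * \prod_(i <- r) f i (G i w).
  rewrite big_cons /g /update eqxx; congr (_ * _); apply: eq_big_seq => i ir.
  by case: eqP => // ix; rewrite -ix ir in xr.
have gint e : \prod_(i <- x :: r) \int[P]_w g e i (G i w) =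
    expR (- (a x ^+ 2 / 2)) * cos e * \prod_(i <- r) \int[P]_w f i (G i w).
  rewrite big_cons -(standard_normal_cos x) /g /update eqxx; congr (_ * _).
  apply: eq_big_seq => i ir.
  by case: eqP => // ix; rewrite -ix ir in xr.
(* cos (u + v) = cos u cos v + cos (u - pi / 2) cos (v + pi / 2): every term is
   again of the required form *)
transitivity (\int[P]_w
  (cos (\sum_(i <- s) a i * G i w + c) * \prod_(i <- x :: r) g 0 i (G i w) +
   cos (\sum_(i <- s) a i * G i w + (c - pi / 2)) *
     \prod_(i <- x :: r) g (pi / 2) i (G i w))).
  apply: eq_Rintegral => w _; rewrite !gprod big_cons -addrA addrC cosD.
  by rewrite addr0 addrA cosBpihalf cosDpihalf; ring.
rewrite RintegralD//; try exact: int.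
rewrite !ih// !gint cos0 cos_pihalf mulr1 !(mulr0, mul0r) addr0 big_cons.
by rewrite mulrDl opprD expRD; ring.
Qed.

Lemma iid_normal_cos (s : seq I) (a : I -> R) (c : R) : uniq s ->
  \int[P]_w cos (\sum_(i <- s) a i * G i w + c) =
  expR (- ((\sum_(i <- s) a i ^+ 2) / 2)) * cos c.
Proof.
move=> us; have := @iid_normal_cos_prod s [::] a (fun _ _ => 1) c.
rewrite cats0 !big_nil mulr1 => <- //.
  by apply: eq_Rintegral => w _; rewrite mulr1.
by move=> i; exact: bcl_base indicators_one.
Qed.

End iid_normal.

(** * Walsh functions on the hypercube *)

Lemma sum_tuple_prod {R : comNzRingType} (N : nat) (F : 'I_N -> bool -> R) :
  \sum_(x : N.-tuple bool) \prod_(k < N) F k (tnth x k) =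
  \prod_(k < N) (F k false + F k true).
Proof.
transitivity (\prod_(k < N) \sum_(b : bool) F k b).
  rewrite bigA_distr_bigA /= (reindex (@tuple_of_finfun bool N)).
    apply: eq_bigr => f _; apply: eq_bigr => k _.
    by rewrite /tuple_of_finfun tnth_mktuple.
  exists finfun_of_tuple => x _; first exact: tuple_of_finfunK.
  exact: finfun_of_tupleK.
by apply: eq_bigr => k _; rewrite big_bool addrC.
Qed.

Section walsh.
Context {R : realType} {N : nat}.
Implicit Types (A : {set 'I_N}) (x y z : N.-tuple bool).

Definition walsh A x : R := \prod_(k in A) (-1) ^+ tnth x k.

Lemma walsh0 x : walsh finset.set0 x = 1.
Proof. by rewrite /walsh big_set0. Qed.

Lemma walsh_addmod2 A x z : walsh A (addmod2 x z) = walsh A x * walsh A z.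
Proof.
rewrite /walsh -big_split /=; apply: eq_bigr => k _.
by rewrite tnth_mktuple signr_addb.
Qed.

Lemma norm_walsh A x : `|walsh A x| = 1.
Proof.
rewrite /walsh normr_prod big1// => k _.
by rewrite normrX normrN1 expr1n.
Qed.

Lemma walsh_orthogonal x y :
  \sum_(A : {set 'I_N}) walsh A x * walsh A y = 2 ^+ N * (x == y)%:R.
Proof.
transitivity (\prod_(k < N) ((-1) ^+ tnth x k * (-1) ^+ tnth y k + 1) : R).
  rewrite bigA_distr; apply: eq_bigr => A _.
  by rewrite /walsh -big_split /= -big_mkcond.
have [<-|xy] := eqVneq x y.
  rewrite mulr1 -[X in _ ^+ X](card_ord N) -prodr_const.
  by apply: eq_bigr => k _; rewrite -expr2 sqrr_sign.
have [k xyk] : exists k, tnth x k != tnth y k.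
  apply/existsP; rewrite -negb_forall; apply: contra xy => /forallP xy.
  by apply/eqP/eq_from_tnth => k; apply/eqP.
rewrite (bigD1 k)//= mulr0; move: xyk.
by case: (tnth x k); case: (tnth y k) => // _; rewrite ?expr0 ?expr1 ?mulr1 ?mul1r ?addNr ?addrN mul0r.
Qed.

Lemma sum_walsh A : \sum_x walsh A x = 2 ^+ N * (A == finset.set0)%:R.
Proof.
have [->|A0] := eqVneq A finset.set0.
  under eq_bigr do rewrite walsh0.
  by rewrite sumr_const card_tuple card_bool mulr1 -natrX.
have [k kA] : exists k, k \in A by apply/set0Pn.
rewrite /walsh mulr0.
under eq_bigr do rewrite big_mkcond /=.
rewrite (sum_tuple_prod (fun k b => if k \in A then (-1) ^+ b else 1)).
by rewrite (bigD1 k)//= kA expr0 expr1 subrr mul0r.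
Qed.

(** Summing over the coordinates outside C kills every Walsh function that
    depends on one of them. *)
Lemma sum_walsh_subcube A (C : {set 'I_N}) x :
  \sum_(z : N.-tuple bool | [forall k, (k \in C) ==> (tnth z k == tnth x k)])
     walsh A z = 2 ^+ (N - #|C|) * (A \subset C)%:R * walsh A x.
Proof.
pose F k b : R := (if k \in C then (b == tnth x k)%:R else 1) *
  (if k \in A then (-1) ^+ b else 1).
transitivity (\prod_(k < N) (F k false + F k true)).
  rewrite -sum_tuple_prod big_mkcond; apply: eq_bigr => z _.
  rewrite /F big_split /=.
  have -> : \prod_(k < N) (if k \in A then (-1) ^+ tnth z k else 1) = walsh A z.
    by rewrite /walsh [RHS]big_mkcond.
  case: ifPn => [/forallP zx|].
    rewrite big1 ?mul1r// => k _; case: ifPn => // kC.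
    by have := zx k; rewrite kC /= => ->.
  rewrite negb_forall => /existsP[k]; rewrite negb_imply => /andP[kC zxk].
  by rewrite (bigD1 k)//= kC (negbTE zxk) mul0r mul0r.
have [AC|] := boolP (A \subset C); last first.
  move=> /subsetPn[k kA kC]; rewrite mulr0 mul0r (bigD1 k)//= /F (negbTE kC) kA.
  by rewrite expr0 expr1 !mul1r subrr mul0r.
have nA k : k \notin C -> (k \in A) = false.
  by move=> kC; apply: contraNF kC => kA; exact: (fintype.subsetP AC).
rewrite mulr1 (bigID (mem C))/= mulrC; congr (_ * _).
  have -> : (N - #|C|)%N = #|~: C| by rewrite [RHS]cardsCs finset.setCK card_ord.
  rewrite -prodr_const big_mkcond [RHS]big_mkcond; apply: eq_bigr => k _.
  rewrite inE; case: ifPn => // kC; rewrite /F (negbTE kC).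
  by rewrite nA// !mulr1.
rewrite [LHS]big_mkcond /walsh [RHS]big_mkcond /=; apply: eq_bigr => k _.
rewrite /F; have [kC|kC] := boolP (k \in C).
  by case: (tnth x k) => /=; rewrite !(mul0r, mul1r, add0r, addr0).
by rewrite nA.
Qed.

End walsh.

(** * Covariance of the field driven by the walk *)

Lemma Rintegral_sum {R : realType} {d} {T : measurableType d}
    (mu : {measure set T -> \bar R}) (I : Type) (s : seq I) (f : I -> T -> R) :
  (forall i, mu.-integrable setT (EFin \o f i)) ->
  mu.-integrable setT (EFin \o (fun w => \sum_(i <- s) f i w)) /\
  \int[mu]_w (\sum_(i <- s) f i w) = \sum_(i <- s) \int[mu]_w f i w.
Proof.
move=> fi; elim: s => [|i s [ih1 ih2]].
  have -> : (fun w => \sum_(i <- [::]) f i w) = cst 0.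
    by apply/funext => w; rewrite big_nil.
  split; first exact: integrable0.
  by rewrite big_nil /Rintegral integral0.
have -> : (fun w => \sum_(j <- i :: s) f j w) =
    (fun w => f i w + \sum_(j <- s) f j w).
  by apply/funext => w; rewrite big_cons.
split; first exact: (integrableD measurableT (fi i) ih1).
by rewrite big_cons RintegralD// ih2.
Qed.

Section independent_functions.
Context {R : realType} {d d1 d2 : measure_display} {T : measurableType d}.
Context {T1 : measurableType d1} {T2 : measurableType d2}.
Variables (P : probability T R) (U : T -> T1) (V : T -> T2).

Lemma indep_Rintegral : measurable_fun setT U -> measurable_fun setT V ->
  indep P U V ->
  forall (f : T1 -> R) (g : T2 -> R), bcl indicators f -> bcl indicators g ->
  \int[P]_w (f (U w) * g (V w)) = \int[P]_w f (U w) * \int[P]_w g (V w).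
Proof.
move=> mU mV UV f g fB gB.
have mpreU (A : set T1) : measurable A -> measurable (U @^-1` A).
  by move=> mA; rewrite -[X in measurable X]setTI; exact: mU.
have mpreV (A : set T2) : measurable A -> measurable (V @^-1` A).
  by move=> mA; rewrite -[X in measurable X]setTI; exact: mV.
have base (A : set T1) (B : set T2) : measurable A -> measurable B ->
    \int[P]_w (\1_A (U w) * \1_B (V w)) =
    \int[P]_w \1_A (U w) * \int[P]_w \1_B (V w).
  move=> mA mB; have mUA := mpreU _ mA; have mVB := mpreV _ mB.
  have ind (E : set T) : measurable E -> \int[P]_w \1_E w = fine (P E).
    by move=> mE; rewrite /Rintegral integral_indic// setIT.
  have -> : \int[P]_w (\1_A (U w) * \1_B (V w)) =
      \int[P]_w \1_(U @^-1` A `&` V @^-1` B) w.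
    by apply: eq_Rintegral => w _; rewrite indicI.
  have -> : \int[P]_w \1_A (U w) = \int[P]_w \1_(U @^-1` A) w by [].
  have -> : \int[P]_w \1_B (V w) = \int[P]_w \1_(V @^-1` B) w by [].
  rewrite !ind//; last exact: measurableI.
  by rewrite UV// fineM// fin_num_measure.
have step (B : set T2) : measurable B -> \int[P]_w (f (U w) * \1_B (V w)) =
    \int[P]_w f (U w) * \int[P]_w \1_B (V w).
  move=> mB; apply: (bcl_Rintegral_indep indicators_bounded (U := U)
      (H := fun w => \1_B (V w))) => //.
  - by apply: (indicators_measurable mV); exists B.
  - by exists 1 => w; rewrite indicE; case: (_ \in _); rewrite ?normr1 ?normr0.
  - exact: indicators_measurable.
  - by move=> _ [A mA ->]; exact: base.
under eq_Rintegral do rewrite mulrC.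
rewrite mulrC; apply: (bcl_Rintegral_indep indicators_bounded (U := V)
  (H := fun w => f (U w))) => //.
- by apply: (bcl_measurable _ fB); exact: indicators_measurable.
- by have [M fM] := bcl_bounded indicators_bounded fB; exists M => w.
- exact: indicators_measurable.
- move=> _ [B mB ->]; under eq_Rintegral do rewrite mulrC.
  by rewrite step// mulrC.
Qed.

End independent_functions.

Lemma cvg_sumr {R : realType} (I : Type) (r : seq I) (Q : pred I)
    (u : I -> nat -> R) (l : I -> R) :
  (forall i, u i n @[n --> \oo] --> l i) ->
  \sum_(i <- r | Q i) u i n @[n --> \oo] --> \sum_(i <- r | Q i) l i.
Proof. by move=> ul; apply: cvg_big => // x; exact: add_continuous. Qed.

Section walk_covariance.
Context {R : realType} {d : measure_display} {T : measurableType d}.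
Variables (P : probability T R) (N : nat).
Variables (Z : {RV P >-> N.-tuple bool}) (X S : nat -> {RV P >-> N.-tuple bool}).
Hypothesis hX : walk Z X S.
Implicit Types (A : {set 'I_N}) (x y z : N.-tuple bool).

Lemma measurable_set1_tuple x : measurable [set x].
Proof.
have -> : [set x] = \bigcap_(k in [set: 'I_N]) (fun z => tnth z k) @^-1` [set tnth x k].
  apply/seteqP; split => [z -> //|z zx]; apply/eq_from_tnth => k.
  exact: zx.
apply: fin_bigcap_measurable => [|k _]; first exact: finite_finset.
by rewrite -[X in measurable X]setTI; exact: (measurable_tnth k).
Qed.

Lemma tuple_fun_bcl (f : N.-tuple bool -> R) : bcl indicators f.
Proof.
have -> : f = fun x => \sum_y f y * \1_[set y] x.
  apply/funext => x; rewrite (bigD1 x)//= indicE mem_set// mulr1 big1 ?addr0//.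
  by move=> y yx; rewrite indicE memNset ?mulr0// => xy; rewrite -xy eqxx in yx.
apply: (bcl_sum (bcl_base indicators_one)) => y _; apply: (bclZ (bcl_base indicators_one)).
by apply: bcl_base; exists [set y] => //; exact: measurable_set1_tuple.
Qed.

Let mX t : measurable_fun setT (X t : T -> N.-tuple bool). Proof. by []. Qed.
Let mS t : measurable_fun setT (S t : T -> N.-tuple bool). Proof. by []. Qed.

(** The part of the trajectory from which the next increment is independent. *)
Definition past t (w : T) := [tuple X (val tau) w | tau < t.+1].

Lemma measurable_past t : measurable_fun setT (past t).
Proof.
apply/measurable_fun_tnthP => k; rewrite (_ : _ \o _ = X k)//.
by apply/funext => w; rewrite /= tnth_mktuple.
Qed.

Definition increment_char A : R := \int[P]_w walsh A (Z w).

(** The next increment is independent of the past, so that each step contributes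
    one factor. *)
Lemma walk_walsh A x t :
  \int[P]_w (walsh A (X t w) * \1_[set x] (X 0%N w)) =
  increment_char A ^+ t * (walsh A x * \int[P]_w \1_[set x] (X 0%N w)).
Proof.
have [_ XS lawS _ indS] := hX.
elim: t => [|t ih].
  rewrite expr0 mul1r -RintegralZl//.
    apply: eq_Rintegral => w _; rewrite indicE.
    by have [/set_mem ->|_] := boolP (_ \in _) => //; rewrite !mulr0.
  apply: bounded_integrable.
    by apply: (indicators_measurable (@mX 0)); exists [set x] => //; exact: measurable_set1_tuple.
  by exists 1 => w; rewrite indicE; case: (_ \in _); rewrite ?normr1 ?normr0.
pose g (v : t.+1.-tuple (N.-tuple bool)) : R :=
  walsh A (tnth v ord_max) * \1_[set x] (tnth v ord0).
have gB : bcl indicators g.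
  have -> : g = fun v => \sum_y walsh A y *
      \1_((fun v => tnth v ord_max) @^-1` [set y] `&`
          (fun v => tnth v ord0) @^-1` [set x]) v.
    apply/funext => v; rewrite /g (bigD1 (tnth v ord_max))//= [X in _ + X]big1.
      by rewrite addr0 indicI /= [X in _ = _ * (X * _)]indicE mem_set// mul1r.
    move=> y yv; rewrite indicI /= [X in _ * (X * _)]indicE memNset ?mul0r ?mulr0//.
    by move=> /= vy; rewrite -vy eqxx in yv.
  apply: (bcl_sum (bcl_base indicators_one)) => y _; apply: (bclZ (bcl_base indicators_one)).
  apply: bcl_base; eexists; last by reflexivity.
  apply: measurableI; rewrite -[X in measurable X]setTI.
    by apply: (measurable_tnth ord_max) => //; exact: measurable_set1_tuple.
  by apply: (measurable_tnth ord0) => //; exact: measurable_set1_tuple.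
have gE w : g (past t w) = walsh A (X t w) * \1_[set x] (X 0%N w).
  by rewrite /g /past !tnth_mktuple.
have := indep_Rintegral (@mS t) (@measurable_past t) (indS t) (tuple_fun_bcl (walsh A)) gB.
under [X in _ = _ * X -> _]eq_Rintegral do rewrite gE.
rewrite ih => e; rewrite exprS -mulrA.
have cS : increment_char A = \int[P]_w walsh A (S t w).
  apply: (bcl_Rintegral_eq (B := indicators) indicators_bounded); last exact: tuple_fun_bcl.
  - exact: indicators_measurable.
  - exact: indicators_measurable.
  - move=> _ [B mB ->]; rewrite /Rintegral.
    have ind (Y : {RV P >-> N.-tuple bool}) :
        (\int[P]_w (\1_B (Y w))%:E)%E = distribution P Y B.
      rewrite -[LHS]/(\int[P]_w (\1_(Y @^-1` B) w)%:E)%E integral_indic ?setIT//.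
      exact: (measurable_funPTI Y mB).
    by rewrite !ind lawS.
rewrite -cS in e; rewrite -e; apply: eq_Rintegral => w _.
by rewrite gE XS walsh_addmod2 mulrCA mulrA.
Qed.

(** In the Walsh basis a step of the walk acts diagonally, by multiplication
    with the character of the increment. *)
Lemma transition_walsh t x y :
  transition X t x y =
  (2 ^+ N)^-1 * \sum_(A : {set 'I_N}) walsh A x * walsh A y * increment_char A ^+ t.
Proof.
have [X0 _ _ _ _] := hX.
have ind (E : set T) : measurable E -> fine (P E) = \int[P]_w \1_E w.
  by move=> mE; rewrite /Rintegral integral_indic// setIT.
have mXx u z : measurable (X u @^-1` [set z]).
  exact: (measurable_funPTI (X u) (measurable_set1_tuple z)).
rewrite /transition !ind//; last exact: measurableI.
have -> : \int[P]_w \1_(X 0%N @^-1` [set x]) w = \int[P]_w \1_[set x] (X 0%N w) by [].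
set p0 := \int[P]_w \1_[set x] (X 0%N w).
have p0_neq0 : p0 != 0.
  rewrite gt_eqF// /p0 -[X in _ < X]/(\int[P]_w \1_(X 0%N @^-1` [set x]) w) -ind//.
  by apply: fine_gt0; rewrite X0 /= -ge0_fin_numE// fin_num_measure.
have iW A : P.-integrable setT
    (EFin \o (fun w => (2 ^+ N)^-1 * walsh A y *
      (walsh A (X t w) * \1_[set x] (X 0%N w)))).
  apply: integrable_scale; apply: bounded_integrable.
    apply: measurable_funM.
      apply: (bcl_measurable _ (tuple_fun_bcl (walsh A))).
      exact: (indicators_measurable (@mX t)).
    by apply: (indicators_measurable (@mX 0)); exists [set x] => //; exact: measurable_set1_tuple.
  exists 1 => w; rewrite normrM norm_walsh mul1r indicE.
  by case: (_ \in _); rewrite ?normr1 ?normr0.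
have -> : \int[P]_w \1_(X t @^-1` [set y] `&` X 0%N @^-1` [set x]) w =
    \int[P]_w (\sum_(A : {set 'I_N}) (2 ^+ N)^-1 * walsh A y *
      (walsh A (X t w) * \1_[set x] (X 0%N w))).
  apply: eq_Rintegral => w _; rewrite indicI /=.
  rewrite (eq_bigr (fun A => (2 ^+ N)^-1 * \1_[set x] (X 0%N w) *
      (walsh A (X t w) * walsh A y))); last by move=> A _; ring.
  rewrite -mulr_sumr walsh_orthogonal.
  have -> : \1_(X t @^-1` [set y]) w = (X t w == y)%:R :> R.
    rewrite indicE; congr (_%:R); congr nat_of_bool.
    by apply/idP/eqP => [/set_mem|e]; [|exact/mem_set].
  have -> : \1_(X 0%N @^-1` [set x]) w = \1_[set x] (X 0%N w) :> R by [].
  by field; rewrite expf_neq0.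
have [_ ->] := Rintegral_sum (index_enum _) iW.
rewrite mulr_suml mulr_sumr; apply: eq_bigr => A _.
rewrite RintegralZl//; last first.
  apply: bounded_integrable.
    apply: measurable_funM.
      apply: (bcl_measurable _ (tuple_fun_bcl (walsh A))).
      exact: (indicators_measurable (@mX t)).
    by apply: (indicators_measurable (@mX 0)); exists [set x] => //; exact: measurable_set1_tuple.
  exists 1 => w; rewrite normrM norm_walsh mul1r indicE.
  by case: (_ \in _); rewrite ?normr1 ?normr0.
rewrite walk_walsh -/p0; field.
by rewrite p0_neq0 expf_neq0.
Qed.

Lemma increment_char_le1 A : `|increment_char A| <= 1.
Proof.
have mW : measurable_fun setT (fun w => walsh A (Z w) : R).
  apply: (bcl_measurable _ (tuple_fun_bcl (walsh A))).
  exact: indicators_measurable.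
have iW : P.-integrable setT (EFin \o (fun w => walsh A (Z w))).
  by apply: bounded_integrable => //; exists 1 => w; rewrite norm_walsh.
rewrite (le_trans (le_normr_Rintegral measurableT iW))//.
under eq_Rintegral do rewrite norm_walsh.
rewrite Rintegral_cst// mul1r [X in fine X](_ : _ = 1%E)//.
exact: probability_setT.
Qed.

Lemma walk_cov_walsh (alpha : R) x y : 0 < alpha < 1 ->
  walk_cov alpha X x y =
  (2 ^+ N)^-1 * \sum_(A : {set 'I_N}) walsh A x * walsh A y *
    ((1 - alpha) / (1 - alpha * increment_char A)).
Proof.
move=> /andP[a0 a1]; rewrite /walk_cov.
have small A : `|alpha * increment_char A| < 1.
  rewrite normrM gtr0_norm// (le_lt_trans _ a1)// ler_piMr//; first exact: ltW.
  exact: increment_char_le1.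
pose c A : R := (2 ^+ N)^-1 * (walsh A x * walsh A y).
have -> : series (fun t => alpha ^+ t * transition X t x y) =
    (fun n => \sum_(A : {set 'I_N}) c A * series (geometric 1 (alpha * increment_char A)) n).
  apply/funext => n; rewrite /series /=.
  under [RHS]eq_bigr do rewrite mulr_sumr.
  rewrite exchange_big /=; apply: eq_bigr => t _.
  rewrite transition_walsh mulrCA mulr_sumr mulr_sumr; apply: eq_bigr => A _.
  by rewrite /c /geometric /= mul1r exprMn; ring.
have cS : (fun n => \sum_(A : {set 'I_N}) c A *
      series (geometric 1 (alpha * increment_char A)) n) @ \oo -->
    \sum_(A : {set 'I_N}) c A * (1 / (1 - alpha * increment_char A)).
  apply: cvg_sumr => A; apply: cvgM; first exact: cvg_cst.
  exact: cvg_geometric_series.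
rewrite (cvg_lim _ cS)// mulr_sumr mulr_sumr; apply: eq_bigr => A _.
by rewrite /c; ring.
Qed.

End walk_covariance.

(** * Linear combinations in Gaussian fields *)

Section gaussian_combinations.
Context {R : realType} {d : measure_display} {T : measurableType d}.
Variable P : probability T R.

(** Square integrability comes for free: the covariances are finite. *)
Lemma centered_gaussian_field_cos (I : finType) (K : I -> I -> R)
    (G : I -> {RV P >-> R}) :
  centered_gaussian_field P K (fun i => G i : T -> R) ->
  forall (a : I -> R) (c : R),
  \int[P]_w cos (\sum_i a i * G i w + c) =
  expR (- ((\sum_i \sum_j a i * a j * K i j) / 2)) * cos c.
Proof.
move=> [gG EG KG] a c.
have mG i : measurable_fun setT (G i : T -> R) by [].
have prodE i j : (\int[P]_w (G i w * G j w)%:E)%E = (K i j)%:E.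
  rewrite -KG unlock !EG unlock; apply: eq_integral => w _ /=.
  by rewrite !fctE /= !subr0.
have iG2 i : P.-integrable setT (EFin \o (fun w => G i w ^+ 2)).
  apply/integrableP; split.
    by apply/measurable_EFinP; exact: measurable_funX.
  rewrite (_ : (\int[P]_w _)%E = (K i i)%:E) ?ltry// -prodE.
  by apply: eq_integral => w _ /=; rewrite ger0_norm ?sqr_ge0// expr2.
have iG i : P.-integrable setT (EFin \o (G i : T -> R)).
  have i1 : P.-integrable setT (EFin \o (fun=> 1 : R)).
    by apply: bounded_integrable => //; exists 1 => w; rewrite normr1.
  apply: (@le_integrable _ _ _ P _ _ _ (EFin \o (fun w => 1 + G i w ^+ 2))) => //.
  - exact/measurable_EFinP.
  - move=> w _ /=; rewrite lee_fin [leRHS]ger0_norm ?addr_ge0 ?sqr_ge0//.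
    rewrite -[X in _ <= _ + X]real_normK ?num_real//; set y := `|_|.
    by have := sqr_ge0 (y - 2^-1); rewrite sqrrB; lra.
  - exact: (integrableD measurableT i1 (iG2 i)).
have iGG i j : P.-integrable setT (EFin \o (fun w => G i w * G j w)).
  apply: (@le_integrable _ _ _ P _ _ _
    (EFin \o (fun w => G i w ^+ 2 + G j w ^+ 2))) => //.
  - by apply/measurable_EFinP; exact: measurable_funM.
  - move=> w _ /=; rewrite lee_fin [leRHS]ger0_norm ?addr_ge0 ?sqr_ge0//.
    rewrite normrM -[X in _ <= X + _]real_normK ?num_real//.
    rewrite -[X in _ <= _ + X]real_normK ?num_real//.
    set y := `|_|; set z := `|_|.
    have := sqr_ge0 (y - z); have := sqr_ge0 (y + z).
    by rewrite sqrrB sqrrD; lra.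
  - exact: (integrableD measurableT (iG2 i) (iG2 j)).
pose Y w := \sum_i a i * G i w.
have [iY EY] := Rintegral_sum (index_enum I) (fun i => integrable_scale (a i) (iG i)).
have Y2 w : Y w ^+ 2 = \sum_i \sum_j a i * a j * (G i w * G j w).
  rewrite expr2 /Y mulr_suml; apply: eq_bigr => i _.
  by rewrite mulr_sumr; apply: eq_bigr => j _; ring.
have inner i := Rintegral_sum (index_enum I)
  (fun j => integrable_scale (a i * a j) (iGG i j)).
have [iY2 EY2] := Rintegral_sum (index_enum I) (fun i => (inner i).1).
apply: (@gaussian_cos _ _ _ P Y) => //.
- have [mY [m [s YB]]] := gG #|I| enum_val (a \o enum_val).
  have YE : Y = fun w => \sum_(j < #|I|) (a \o enum_val) j * G (enum_val j) w.
    apply/funext => w; rewrite /Y (reindex (@enum_val I predT))//=.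
    by apply: onW_bij; exact: enum_val_bij.
  by rewrite YE; split => //; exists m, s.
- by have := iY2; congr (_.-integrable _ _); apply/funext => w; rewrite /= Y2.
- rewrite EY big1// => i _; rewrite RintegralZl//.
  rewrite (_ : \int[P]_w G i w = 0) ?mulr0// /Rintegral.
  by have := EG i; rewrite unlock => ->.
- under eq_Rintegral do rewrite Y2.
  rewrite EY2; apply: eq_bigr => i _; rewrite (inner i).2; apply: eq_bigr => j _.
  by rewrite RintegralZl//; congr (_ * _); rewrite /Rintegral prodE.
Qed.

(** The characteristic function exp (- a^2 v / 2) belongs to the normal law of
    variance v; for v = 0 that is a point mass. *)
Lemma gaussian_rv_of_cos (Y : T -> R) (v : R) : measurable_fun setT Y -> 0 <= v ->
  (forall a c, \int[P]_w cos (a * Y w + c) = expR (- (a ^+ 2 * v / 2)) * cos c) ->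
  gaussian_rv P Y.
Proof.
move=> mY v0 cosY; split => //; exists 0, (Num.sqrt v) => B mB.
have mid : measurable_fun setT (id : measurableTypeR R -> R) by [].
rewrite /normal_law; case: eqVneq => [s0|s0].
  have v0' : v = 0 by rewrite -(sqr_sqrtr v0) s0 expr0n.
  pose nu : probability (measurableTypeR R) R := @dirac _ (measurableTypeR R) 0 R.
  apply: (trig_determines_law (Q := nu) (V := id) mY mid _ mB) => a c.
  rewrite cosY v0' mulr0 mul0r oppr0 expR0 mul1r /Rintegral.
  rewrite (@integral_dirac _ (measurableTypeR R))//; last first.
    apply/measurable_EFinP; apply: measurable_cos_comp.
    by apply: measurable_funD => //; exact: measurable_funM.
  by rewrite diracT mul1e mulr0 add0r.
apply: (trig_determines_law (Q := normal_prob 0 (Num.sqrt v)) (V := id) mY mid _ mB).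
move=> a c; rewrite cosY -[X in a ^+ 2 * X]sqr_sqrtr// mulrC.
have := cos_normal 0 s0 c a; rewrite [_ ^+ 2 * _]mulrC => e.
rewrite mulrC -e; apply: eq_Rintegral => x _; rewrite subr0 //.
Qed.

End gaussian_combinations.

Section iid_combinations.
Context {R : realType} {d : measure_display} {T : measurableType d}.
Variables (P : probability T R) (I : choiceType) (G : I -> {RV P >-> R}).
Hypothesis hG : iid_standard_normal G.
Variable r : seq I.
Hypothesis ur : uniq r.
Implicit Types a b : I -> R.

Definition combination a (w : T) : R := \sum_(i <- r) a i * G i w.

Lemma measurable_combination a : measurable_fun setT (combination a).
Proof.
have mG i : measurable_fun setT (fun w => a i * G i w) by exact: measurable_funM.
exact: (measurable_sum r mG).
Qed.

Lemma combination_gaussian a : gaussian_rv P (combination a).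
Proof.
apply: (@gaussian_rv_of_cos _ _ _ _ _ (\sum_(i <- r) a i ^+ 2)).
- exact: measurable_combination.
- by apply: sumr_ge0 => i _; exact: sqr_ge0.
move=> t c; have := iid_normal_cos hG (fun i => t * a i) c ur.
rewrite (eq_bigr (fun i => t ^+ 2 * a i ^+ 2)) => [|i _]; last by rewrite exprMn.
rewrite -mulr_sumr => <-; apply: eq_Rintegral => w _; congr (cos (_ + _)).
by rewrite /combination mulr_sumr; apply: eq_bigr => i _; rewrite mulrA.
Qed.

(** The cross term in the variance of a sum vanishes, so that the joint
    characteristic function factors. *)
Lemma combination_indep a b : (forall i, i \in r -> a i * b i = 0) ->
  indep P (combination a) (combination b).
Proof.
move=> ab0; have mab t u e : measurable_fun setT
    (fun w => cos (t * combination a w + u * combination b w + e)).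
  apply: measurable_cos_comp; apply: measurable_funD => //.
  by apply: measurable_funD; apply: measurable_funM => //; exact: measurable_combination.
have iab t u e : P.-integrable setT (EFin \o
    (fun w => cos (t * combination a w + u * combination b w + e))).
  apply: bounded_integrable => //.
  by exists 1 => w; rewrite ler_norml cos_geN1 cos_le1.
pose va := \sum_(i <- r) a i ^+ 2; pose vb := \sum_(i <- r) b i ^+ 2.
have cosab t u e : \int[P]_w cos (t * combination a w + u * combination b w + e) =
    expR (- (t ^+ 2 * va / 2)) * expR (- (u ^+ 2 * vb / 2)) * cos e.
  have := iid_normal_cos hG (fun i => t * a i + u * b i) e ur.
  rewrite (eq_big_seq (fun i => t ^+ 2 * a i ^+ 2 + u ^+ 2 * b i ^+ 2)) => [|i ir].
    rewrite big_split /= -!mulr_sumr -/va -/vb mulrDl opprD expRD => <-.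
    apply: eq_Rintegral => w _; congr (cos (_ + _)).
    rewrite /combination !mulr_sumr -big_split; apply: eq_bigr => i _ /=.
    by rewrite mulrDl !mulrA.
  rewrite sqrrD !exprMn -mulrA (_ : t * a i * (u * b i) = t * u * (a i * b i)); last by ring.
  by rewrite ab0// mulr0 mul0rn addr0.
apply: trig_determines_indep; [exact: measurable_combination..|move=> t u c e].
have -> : \int[P]_w (cos (t * combination a w + c) * cos (u * combination b w + e)) =
    \int[P]_w (2^-1 * cos (t * combination a w + (- u) * combination b w + (c - e)) +
               2^-1 * cos (t * combination a w + u * combination b w + (c + e))).
  apply: eq_Rintegral => w _; rewrite cosM.
  by congr (_ * cos _ + _ * cos _); ring.
rewrite RintegralD//; try exact: integrable_scale.
rewrite !RintegralZl// !cosab.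
have := cosab t 0 c; under eq_Rintegral do rewrite mul0r addr0.
rewrite expr0n /= !mul0r oppr0 expR0 mulr1 => ->.
have := cosab 0 u e; under eq_Rintegral do rewrite mul0r add0r.
rewrite expr0n /= !mul0r oppr0 expR0 mul1r => ->.
by rewrite sqrrN cosB cosD; field.
Qed.

End iid_combinations.

(** * The finite-dimensional laws *)

Section coordinates.
Context {R : realType}.
Implicit Types (x : nat -> bool) (A C U : {fset nat}).

Definition nonempty_subsets U : seq {fset nat} := [seq A <- fpowerset U | A != fset0].

(** The coefficient of g_A / sqrt (1 + b_A) in the limit field; the factor
    A `<=` C allows summation over a common index set for several C. *)
Definition walsh_coef x C A : R :=
  2 `^ (- #|` C|%:R / 2) * (A `<=` C)%fset%:R * \prod_(k <- A) (-1) ^+ x k.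

Lemma nonempty_subsets_uniq U : uniq (nonempty_subsets U).
Proof. exact/filter_uniq/fset_uniq. Qed.

Lemma mem_nonempty_subsets U A : (A \in nonempty_subsets U) = (A `<=` U)%fset && (A != fset0).
Proof. by rewrite mem_filter fpowersetE andbC. Qed.

Lemma ginfty_combination {T : Type} (b : {fset nat} -> R)
    (G : {fset nat} -> T -> R) x C U w : (C `<=` U)%fset ->
  ginfty b G x C w =
  \sum_(A <- nonempty_subsets U) walsh_coef x C A / Num.sqrt (1 + b A) * G A w.
Proof.
move=> CU; rewrite /ginfty.
have perm : perm_eq [seq A <- fpowerset C | A != fset0]
    [seq A <- nonempty_subsets U | (A `<=` C)%fset].
  apply: uniq_perm; [exact: nonempty_subsets_uniq|exact/filter_uniq/nonempty_subsets_uniq|move=> A].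
  rewrite !mem_filter !fpowersetE.
  have [AC|] := boolP (A `<=` C)%fset; last by rewrite andbF.
  by rewrite (fsubset_trans AC CU).
rewrite -big_filter (perm_big _ perm) big_filter mulr_sumr.
rewrite big_mkcond; apply: eq_bigr => A _.
rewrite /walsh_coef; case: ifP => _; last by rewrite mulr0 !mul0r.
by rewrite mulr1 !mulrA.
Qed.

End coordinates.

Section fset_of_set.
Context {N : nat}.
Implicit Types (A : {set 'I_N}).

(** Subsets of {0, ..., N - 1} occur both as finite sets of naturals, which index
    the limit, and as sets of ordinals, which index the Walsh basis; [ords_of]
    and [fset_of] translate. *)
Definition ords_of (C : {fset nat}) : {set 'I_N} := finset (fun k => val k \in C).

Lemma mem_ords_of C k : (k \in ords_of C) = (val k \in C).
Proof. by rewrite /ords_of inE. Qed.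

Definition fset_of A : {fset nat} := [fset k in [seq val i | i <- enum A]]%fset.

Lemma mem_fset_of A (k : 'I_N) : (val k \in fset_of A) = (k \in A).
Proof.
by rewrite /fset_of !inE mem_map ?mem_enum//; exact: val_inj.
Qed.

Lemma mem_fset_ofP A (k : nat) : k \in fset_of A -> exists2 i : 'I_N, i \in A & k = i.
Proof.
rewrite /fset_of !inE => /mapP[i]; rewrite mem_enum => iA ->; by exists i.
Qed.

Lemma fset_of_inj : injective fset_of.
Proof. by move=> A B AB; apply/setP => k; rewrite -!mem_fset_of AB. Qed.

Lemma perm_fset_of A : perm_eq (fset_of A) [seq val i | i <- enum A].
Proof.
apply: uniq_perm => //.
- by rewrite map_inj_uniq ?enum_uniq//; exact: val_inj.
- by move=> k; rewrite /fset_of !inE.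
Qed.

Lemma fset_of_sub A (C : {fset nat}) :
  (fset_of A `<=` C)%fset = (A \subset ords_of C).
Proof.
apply/fsubsetP/fintype.subsetP => [AC k kA|AC k /mem_fset_ofP[i iA ->]].
  by rewrite mem_ords_of; apply: AC; rewrite mem_fset_of.
by have := AC i iA; rewrite mem_ords_of.
Qed.

Lemma perm_nonempty_subsets :
  perm_eq (nonempty_subsets [fset k in iota 0 N]%fset)
    [seq fset_of A | A <- enum (fun A : {set 'I_N} => A != finset.set0)].
Proof.
apply: uniq_perm; first exact: nonempty_subsets_uniq.
  by rewrite map_inj_uniq ?enum_uniq//; exact: fset_of_inj.
move=> B; rewrite mem_nonempty_subsets; apply/andP/mapP => [[BN B0]|[A]].
  have BE : B = fset_of (ords_of B).
    apply/fsetP => k; apply/idP/idP => [kB|/mem_fset_ofP[i]]; last by rewrite mem_ords_of => iB ->.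
    have kN : (k < N)%N by have := fsubsetP BN k kB; rewrite !inE mem_iota.
    by rewrite (mem_fset_of _ (Ordinal kN)) mem_ords_of.
  exists (ords_of B) => //.
  rewrite mem_enum; apply: contra B0 => /eqP B0; rewrite BE B0.
  apply/eqP/fsetP => k; rewrite in_fset0; apply/negbTE/negP.
  by move=> /mem_fset_ofP[i]; rewrite finset.inE.
rewrite mem_enum => A0 ->; split.
  apply/fsubsetP => k /mem_fset_ofP[i iA ->].
  by rewrite !inE mem_iota add0n /= ltn_ord.
apply: contra A0 => /eqP A0; apply/eqP/setP => k.
by rewrite -mem_fset_of A0 !inE.
Qed.

Lemma card_ord_fset (C : {fset nat}) : (forall k, k \in C -> (k < N)%N) ->
  #|ords_of C| = #|` C|.
Proof.
move=> CN; have CE : C = fset_of (ords_of C).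
  apply/fsetP => k; apply/idP/idP => [kC|/mem_fset_ofP[i]]; last by rewrite mem_ords_of => iB ->.
  by rewrite (mem_fset_of _ (Ordinal (CN k kC))) mem_ords_of.
by rewrite [in RHS]CE (perm_size (perm_fset_of _)) size_map -cardE.
Qed.

Lemma prod_fset_of {R : realType} A (x : nat -> bool) :
  \prod_(k <- fset_of A) (-1) ^+ x k = walsh A [tuple x k | k < N] :> R.
Proof.
rewrite (perm_big _ (perm_fset_of A)) big_map /walsh big_enum /=.
by apply: eq_bigr => k _; rewrite tnth_mktuple.
Qed.

Lemma rhoE {R : realType} {d} {T : measurableType d} (P : probability T R)
    (Z : {RV P >-> N.-tuple bool}) (A : {fset nat}) :
  rho Z A = increment_char Z (ords_of A).
Proof.
rewrite /rho unlock /increment_char /Rintegral; congr fine; apply: eq_integral => w _.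
by rewrite /walsh; congr EFin; apply: eq_bigl => k; rewrite mem_ords_of.
Qed.

End fset_of_set.

Section marginals.
Context {R : realType} {N : nat}.
Context {dW : measure_display} {W : measurableType dW} (PW : probability W R).
Variables (Z : {RV PW >-> N.-tuple bool}) (X S : nat -> {RV PW >-> N.-tuple bool}).
Hypothesis hwalk : walk Z X S.
Variable alpha : R.
Hypothesis halpha : 0 < alpha < 1.
Context {d : measure_display} {T : measurableType d} (P : probability T R).
Variable g : N.-tuple bool -> {RV P >-> R}.
Hypothesis hg : centered_gaussian_field P (walk_cov alpha X) (fun x => g x : T -> R).

(** The sequence with limit b_A. *)
Definition prelimit_b (A : {fset nat}) : R := alpha / (1 - alpha) * (1 - rho Z A).

Lemma prelimit_b_ge0 A : 0 <= prelimit_b A.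
Proof.
have /andP[a0 a1] := halpha; rewrite /prelimit_b mulr_ge0//.
  by rewrite divr_ge0 ?subr_ge0// ltW.
have := increment_char_le1 Z (ords_of A); rewrite -rhoE ler_norml => /andP[_].
by rewrite subr_ge0.
Qed.

Lemma prelimit_bE (A : {set 'I_N}) :
  (1 - alpha) / (1 - alpha * increment_char Z A) = (1 + prelimit_b (fset_of A))^-1.
Proof.
have /andP[a0 a1] := halpha; have b0 := prelimit_b_ge0 (fset_of A).
have AE : ords_of (fset_of A) = A by apply/setP => k; rewrite mem_ords_of mem_fset_of.
rewrite /prelimit_b rhoE AE in b0 *.
have a1' : 1 - alpha != 0 by rewrite subr_eq0 eq_sym lt_eqF.
have -> : 1 + alpha / (1 - alpha) * (1 - increment_char Z A) =
    (1 - alpha * increment_char Z A) / (1 - alpha) by field.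
by rewrite invf_div.
Qed.

Definition subcube (x : nat -> bool) (C : {fset nat}) (z : N.-tuple bool) : bool :=
  [forall k : 'I_N, (val k \in C) ==> (tnth z k == x k)].

Definition subcube_size x C : R := \sum_(z | subcube x C z) 1.

Definition marginal_scale (C : {fset nat}) : R := 2 `^ (- (N%:R - #|` C|%:R) / 2).

Definition marginal_coef x C (z : N.-tuple bool) : R :=
  marginal_scale C * ((subcube x C z)%:R - subcube_size x C * (2 ^+ N)^-1).

Lemma marginalE x C w :
  marginal (fun x => g x : T -> R) x C w = \sum_z marginal_coef x C z * g z w.
Proof.
rewrite /marginal -/(marginal_scale C) /centered sumrB.
have -> : \sum_(z | subcube x C z) (2 ^+ N)^-1 * (\sum_y g y w) =
    subcube_size x C * (2 ^+ N)^-1 * \sum_y g y w.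
  rewrite /subcube_size mulr_suml mulr_suml; apply: eq_bigr => z _.
  by rewrite mul1r.
rewrite [X in _ * (X - _)]big_mkcond [X in _ * (_ - X)]mulr_sumr -sumrB mulr_sumr.
apply: eq_bigr => z _; rewrite /marginal_coef -/(subcube x C z).
by case: (subcube x C z); rewrite /= ?mulr1n ?mulr0n; ring.
Qed.

Lemma powR2_half (t : R) : 2 `^ (t / 2) * 2 `^ (t / 2) = 2 `^ t :> R.
Proof.
rewrite -powRD; last by rewrite pnatr_eq0 implybT.
by rewrite -splitr.
Qed.

(** The normalisation of the marginal averages turns the Walsh coefficient of
    the subcube into one independent of N, up to the factor from Parseval. *)
Lemma walsh_marginal_coef x C (A : {set 'I_N}) : (forall k, k \in C -> (k < N)%N) ->
  \sum_z marginal_coef x C z * walsh A z =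
  (A != finset.set0)%:R * (2 `^ (N%:R / 2) * walsh_coef x C (fset_of A)).
Proof.
move=> CN.
have subE z : subcube x C z = [forall k, (k \in ords_of C) ==>
    (tnth z k == tnth [tuple x k | k < N] k)].
  by apply: eq_forallb => k; rewrite mem_ords_of tnth_mktuple.
have sumE : \sum_z marginal_coef x C z * walsh A z =
    marginal_scale C * (\sum_(z | subcube x C z) walsh A z -
               subcube_size x C * (2 ^+ N)^-1 * \sum_z walsh A z).
  rewrite [X in _ * (X - _)]big_mkcond mulr_sumr -sumrB mulr_sumr.
  apply: eq_bigr => z _; rewrite /marginal_coef.
  by case: (subcube x C z); rewrite /= ?mulr1n ?mulr0n; ring.
rewrite sumE sum_walsh.
have [->|A0] := eqVneq A finset.set0.
  rewrite mul0r mulr1 mulfVK ?expf_neq0//.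
  rewrite (eq_bigr (fun=> 1)) => [|z _]; last exact: walsh0.
  by rewrite subrr mulr0.
rewrite mulr0 mulr0 subr0 mul1r.
rewrite (eq_bigl _ _ subE) sum_walsh_subcube card_ord_fset//.
rewrite /walsh_coef fset_of_sub prod_fset_of !mulrA; congr (_ * _ * _).
rewrite /marginal_scale -powR_mulrn// -!powRD; last 2 first.
  by rewrite pnatr_eq0 implybT.
  by rewrite pnatr_eq0 implybT.
congr (_ `^ _); rewrite natrB; first by field.
by rewrite -(card_ord_fset CN) -[X in (_ <= X)%N](card_ord N) max_card.
Qed.

(** Parseval: the variance of the combination is the sum over A of the weight of
    A times the square of the Walsh coefficient. *)
Lemma marginal_cos (n : nat) (x : 'I_n -> nat -> bool) (C : 'I_n -> {fset nat})
    (a : 'I_n -> R) (c : R) : (forall j k, k \in C j -> (k < N)%N) ->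
  \int[P]_w cos (\sum_j a j * marginal (fun x => g x : T -> R) (x j) (C j) w + c) =
  expR (- ((\sum_(A <- nonempty_subsets [fset k in iota 0 N]%fset)
    (\sum_j a j * (walsh_coef (x j) (C j) A / Num.sqrt (1 + prelimit_b A))) ^+ 2) / 2)) * cos c.
Proof.
move=> CN; pose cz z := \sum_j a j * marginal_coef (x j) (C j) z.
have margE w : \sum_j a j * marginal (fun x => g x : T -> R) (x j) (C j) w =
    \sum_z cz z * g z w.
  under eq_bigr do rewrite marginalE mulr_sumr.
  rewrite exchange_big; apply: eq_bigr => z _ /=.
  by rewrite /cz mulr_suml; apply: eq_bigr => j _; rewrite mulrA.
under eq_Rintegral do rewrite margE.
rewrite (centered_gaussian_field_cos hg); congr (expR (- (_ / 2)) * _).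
transitivity (\sum_(A : {set 'I_N}) (1 + prelimit_b (fset_of A))^-1 * (2 ^+ N)^-1 *
    (\sum_z cz z * walsh A z) ^+ 2).
  transitivity (\sum_z \sum_z' \sum_(A : {set 'I_N})
      (1 + prelimit_b (fset_of A))^-1 * (2 ^+ N)^-1 *
      ((cz z * walsh A z) * (cz z' * walsh A z'))).
    apply: eq_bigr => z _; apply: eq_bigr => z' _.
    rewrite (walk_cov_walsh hwalk)// [X in _ * X]mulr_sumr [LHS]mulr_sumr.
    apply: eq_bigr => A _.
    by rewrite prelimit_bE; ring.
  under eq_bigr do rewrite exchange_big.
  rewrite exchange_big; apply: eq_bigr => A _ /=.
  rewrite expr2 mulr_suml mulr_sumr; apply: eq_bigr => z _.
  by rewrite !mulr_sumr.
rewrite [RHS](perm_big _ perm_nonempty_subsets) [RHS]big_map [RHS]big_enum.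
rewrite [RHS]big_mkcond /=.
apply: eq_bigr => A _.
have -> : \sum_z cz z * walsh A z =
    (A != finset.set0)%:R * (2 `^ (N%:R / 2) *
      \sum_j a j * walsh_coef (x j) (C j) (fset_of A)).
  under eq_bigr do rewrite mulr_suml.
  rewrite exchange_big !mulr_sumr; apply: eq_bigr => j _ /=.
  under eq_bigr do rewrite -mulrA.
  rewrite -mulr_sumr walsh_marginal_coef; last exact: CN.
  by ring.
rewrite unfold_in; case: (A != finset.set0); last by rewrite mul0r expr0n mulr0.
rewrite mul1r exprMn [(2 `^ _) ^+ 2]expr2 powR2_half powR_mulrn//.
rewrite -mulrA mulKf ?expf_neq0//.
under [in RHS]eq_bigr do rewrite mulrA.
rewrite -mulr_suml exprMn exprVn sqr_sqrtr; first by rewrite mulrC.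
by rewrite addr_ge0// prelimit_b_ge0.
Qed.

Lemma measurable_marginal x C :
  measurable_fun setT (marginal (fun x => g x : T -> R) x C).
Proof.
rewrite (_ : marginal _ _ _ = fun w => \sum_z marginal_coef x C z * g z w); last first.
  by apply/funext => w; exact: marginalE.
have mm z : measurable_fun setT (fun w => marginal_coef x C z * g z w).
  exact: measurable_funM.
exact: (measurable_sum (index_enum _) mm).
Qed.

End marginals.

Section limit_field.
Context {R : realType} {d : measure_display} {T : measurableType d}.
Variables (Q : probability T R) (gA : {fset nat} -> {RV Q >-> R}).
Hypothesis hgA : iid_standard_normal gA.
Variable b : {fset nat} -> R.
Local Notation ginf := (ginfty b (fun A => gA A : T -> R)).

Lemma ginfty_eq_on (x y : nat -> bool) (C : {fset nat}) :
  {in C, x =1 y} -> ginf x C = ginf y C.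
Proof.
move=> xy; apply/funext => w; rewrite /ginfty; congr (_ * _).
rewrite big_seq_cond [RHS]big_seq_cond; apply: eq_bigr => A /andP[].
rewrite fpowersetE => /fsubsetP AC _; congr (_ * _ * _).
by apply: eq_big_seq => k kA; rewrite xy//; exact: AC.
Qed.

Lemma sum_ginfty (n : nat) (x : 'I_n -> nat -> bool) (C : 'I_n -> {fset nat})
    (a : 'I_n -> R) (U : {fset nat}) : (forall j, C j `<=` U)%fset ->
  (fun w => \sum_j a j * ginf (x j) (C j) w) = combination gA (nonempty_subsets U)
    (fun A => \sum_j a j * (walsh_coef (x j) (C j) A / Num.sqrt (1 + b A))).
Proof.
move=> CU; apply/funext => w; rewrite /combination.
under eq_bigr do rewrite (ginfty_combination _ _ _ _ (CU _)) mulr_sumr.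
rewrite exchange_big; apply: eq_bigr => A _ /=.
by rewrite mulr_suml; apply: eq_bigr => j _; rewrite mulrA.
Qed.

Lemma ginfty_gaussian :
  gaussian_field Q (fun xC : (nat -> bool) * {fset nat} => ginf xC.1 xC.2).
Proof.
move=> n i a; pose U := \big[@fsetU _/fset0]_(j < n) (i j).2.
have CU j : ((i j).2 `<=` U)%fset by exact: bigfcup_sup (mem_index_enum j) _.
rewrite (sum_ginfty (fun j => (i j).1) a CU).
by apply: combination_gaussian => //; exact: nonempty_subsets_uniq.
Qed.

(** A set in the index set of both sums would be a nonempty subset of the
    empty intersection. *)
Lemma ginfty_indep (x y : nat -> bool) (Cx Cy : {fset nat}) :
  (Cx `&` Cy)%fset = fset0 -> indep Q (ginf x Cx) (ginf y Cy).
Proof.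
move=> Cxy; pose U := (Cx `|` Cy)%fset.
have gE z C : (C `<=` U)%fset -> ginf z C = combination gA (nonempty_subsets U)
    (fun A => walsh_coef z C A / Num.sqrt (1 + b A)).
  by move=> CU; apply/funext => w; rewrite (ginfty_combination _ _ _ _ CU).
rewrite !gE ?fsubsetUl ?fsubsetUr//.
apply: combination_indep => //; first exact: nonempty_subsets_uniq.
move=> A; rewrite mem_nonempty_subsets => /andP[_ A0].
have [ACx|] := boolP (A `<=` Cx)%fset; last first.
  by move=> /negbTE nACx; rewrite /walsh_coef nACx mulr0 !mul0r.
have [ACy|] := boolP (A `<=` Cy)%fset; last first.
  by move=> /negbTE nACy; rewrite /walsh_coef nACy mulr0 !mul0r mulr0.
move/negP : A0; case; rewrite -fsubset0 -Cxy.
by rewrite fsubsetI ACx ACy.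
Qed.

Lemma measurable_ginfty (b' : {fset nat} -> R) x C :
  measurable_fun setT (ginfty b' (fun A => gA A : T -> R) x C).
Proof.
rewrite (_ : ginfty _ _ _ _ = combination gA (nonempty_subsets C)
    (fun A => walsh_coef x C A / Num.sqrt (1 + b' A))).
  exact: measurable_combination.
by apply/funext => w; rewrite (ginfty_combination _ _ _ _ (fsubset_refl C)).
Qed.

Lemma ginfty_cos (n : nat) (x : 'I_n -> nat -> bool) (C : 'I_n -> {fset nat})
    (a : 'I_n -> R) (c : R) (U : {fset nat}) : (forall j, C j `<=` U)%fset ->
  \int[Q]_w cos (\sum_j a j * ginf (x j) (C j) w + c) =
  expR (- ((\sum_(A <- nonempty_subsets U)
    (\sum_j a j * (walsh_coef (x j) (C j) A / Num.sqrt (1 + b A))) ^+ 2) / 2)) * cos c.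
Proof.
move=> CU; have ur := nonempty_subsets_uniq U.
rewrite -(iid_normal_cos hgA _ _ ur); apply: eq_Rintegral => w _.
by have /(congr1 (fun h => h w)) /= -> := sum_ginfty x a CU.
Qed.

(** Pointwise in the outcome, as a finite sum of continuous functions of the
    parameters. *)
Lemma cvg_ginfty (bN : nat -> {fset nat} -> R) x C w :
  (forall A, 0 < 1 + b A) -> (forall A, bN N A @[N --> \oo] --> b A) ->
  ginfty (bN N) (fun A => gA A : T -> R) x C w @[N --> \oo] --> ginf x C w.
Proof.
move=> b0 bNb; apply: cvgM; first exact: cvg_cst.
apply: cvg_sumr => A; apply: cvgM; last exact: cvg_cst.
apply: cvgM; first exact: cvg_cst.
apply: cvgV; first by rewrite gt_eqF// sqrtr_gt0.
apply: (cvg_comp (fun N => 1 + bN N A)); last exact: sqrt_continuous.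
by apply: cvgD; [exact: cvg_cst|exact: bNb].
Qed.

End limit_field.

Theorem proposition5 (R : realType)
  (* the walk driven by Z^(N), for each N *)
  (dW : nat -> measure_display) (W : forall N, measurableType (dW N))
  (PW : forall N, probability (W N) R)
  (Z : forall N, {RV (PW N) >-> N.-tuple bool})
  (X S : forall N, nat -> {RV (PW N) >-> N.-tuple bool})
  (hwalk : forall N, walk (Z N) (X N) (S N))
  (alpha : nat -> R) (halpha : forall N, 0 < alpha N < 1)
  (* the Gaussian field (g_x), for each N *)
  (dG : nat -> measure_display) (Om : forall N, measurableType (dG N))
  (P : forall N, probability (Om N) R)
  (g : forall N, N.-tuple bool -> {RV (P N) >-> R})
  (hg : forall N, centered_gaussian_field (P N)
          (walk_cov (alpha N) (X N)) (fun x => g N x : Om N -> R))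
  (halpha1 : alpha N @[N --> \oo] --> (1 : R))
  (hrho1 : forall A : {fset nat}, rho (Z N) A @[N --> \oo] --> (1 : R))
  (b : {fset nat} -> R)
  (hb : forall A : {fset nat},
     alpha N / (1 - alpha N) * (1 - rho (Z N) A) @[N --> \oo] --> b A)
  (* the i.i.d. standard normal family (g_A) *)
  (dQ : measure_display) (OmQ : measurableType dQ) (Q : probability OmQ R)
  (gA : {fset nat} -> {RV Q >-> R}) (hgA : iid_standard_normal gA) :
  let ginf := ginfty b (fun A => gA A : OmQ -> R) in
  [/\ forall A, 0 < 1 + b A,
      forall (x y : nat -> bool) (C : {fset nat}),
        {in C, x =1 y} -> ginf x C = ginf y C,
      gaussian_field Q (fun xC : (nat -> bool) * {fset nat} => ginf xC.1 xC.2),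
      cvg_fdd P Q
        (fun N (xC : (nat -> bool) * {fset nat}) =>
           marginal (fun x => g N x : Om N -> R) xC.1 xC.2)
        (fun xC : (nat -> bool) * {fset nat} => ginf xC.1 xC.2) &
      forall (x y : nat -> bool) (Cx Cy : {fset nat}),
        (Cx `&` Cy)%fset = fset0 ->
        indep Q (ginf x Cx) (ginf y Cy)].
Proof.
move=> ginf.
pose bN N A := prelimit_b (Z N) (alpha N) A.
have b0 A : 0 < 1 + b A.
  rewrite ltr_pwDl// -(cvg_lim _ (hb A))//.
  apply: limr_ge; first by apply/cvg_ex; exists (b A); exact: hb.
  by apply: nearW => N; exact: (prelimit_b_ge0 (Z N) (halpha N)).
split => //.
- exact: ginfty_eq_on.
- exact: ginfty_gaussian.
- move=> n i f cf bf.
  (* V N is the limit field with the parameters of stage N *)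
  pose V N w := \row_j ginfty (bN N) (fun A => gA A : OmQ -> R) (i j).1 (i j).2 w.
  have mV N j : measurable_fun setT (fun w => V N w 0 j).
    rewrite (_ : (fun w => _) = ginfty (bN N) (fun A => gA A : OmQ -> R) (i j).1 (i j).2).
      exact: measurable_ginfty.
    by apply/funext => w; rewrite mxE.
  (* beyond N0 all the sets C_j consist of coordinates of the hypercube *)
  pose N0 := \max_(j < n) \max_(k <- (i j).2) k.+1.
  have iN N j k : (N0 <= N)%N -> k \in (i j).2 -> (k < N)%N.
    move=> N0N kC; apply: leq_trans N0N.
    apply: leq_trans (leq_bigmax j).
    by apply: leq_bigmax_seq.
  have law N : (N0 <= N)%N -> [/\
      measurable_fun setT (fun w => f (\row_j marginal (fun x => g N x : Om N -> R) (i j).1 (i j).2 w)),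
      measurable_fun setT (fun w => f (V N w)) &
      \int[P N]_w f (\row_j marginal (fun x => g N x : Om N -> R) (i j).1 (i j).2 w) =
      \int[Q]_w f (V N w)].
    move=> N0N; apply: trig_determines_expectation => //.
    + move=> j; rewrite (_ : (fun w => _) =
          marginal (fun x => g N x : Om N -> R) (i j).1 (i j).2).
        exact: measurable_marginal.
      by apply/funext => w; rewrite mxE.
    + move=> a c; under eq_Rintegral do under eq_bigr do rewrite mxE.
      under [RHS]eq_Rintegral do under eq_bigr do rewrite mxE.
      rewrite (marginal_cos (hwalk N) (halpha N) (hg N)); last first.
        by move=> j k; exact: iN.
      rewrite (@ginfty_cos _ _ _ _ _ hgA _ _ _ _ _ _ [fset k in iota 0 N]%fset)//.
      move=> j; apply/fsubsetP => k kC.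
      by rewrite !inE mem_iota /= add0n (iN N j).
  have [M fM] := bf.
  (* the law of V N is only compared beyond N0, hence the shift by maxn *)
  have mf N : measurable_fun setT (fun w => f (V (maxn N0 N) w)).
    by have [] := law _ (leq_maxl N0 N).
  have VV w : V N w @[N --> \oo] --> \row_j ginf (i j).1 (i j).2 w.
    apply: cvg_rV => j; rewrite mxE.
    rewrite (_ : (fun N => _) =
        (fun N => ginfty (bN N) (fun A => gA A : OmQ -> R) (i j).1 (i j).2 w)).
      by apply: cvg_ginfty => // A; exact: hb.
    by apply/funext => N; rewrite mxE.
  have fV w : f (V N w) @[N --> \oo] --> f (\row_j ginf (i j).1 (i j).2 w).
    by apply: continuous_cvg; [exact: cf|exact: VV].
  have fV' w : f (V (maxn N0 N) w) @[N --> \oo] --> f (\row_j ginf (i j).1 (i j).2 w).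
    apply: cvg_trans (fV w); apply: near_eq_cvg; near=> N.
    rewrite (maxn_idPr _)//; near: N; exact: nbhs_infty_ge.
  have cE := @cvg_bounded_Rintegral _ _ _ Q M _ _ mf (fun N w => fM _) fV'.
  rewrite (_ : 'E_Q[_]%E =
      (\int[Q]_w f (\row_j ginf (i j).1 (i j).2 w))%:E); last first.
    rewrite expectation_Rintegral//; apply: bounded_integrable; last by exists M.
    exact: cvg_measurable mf fV'.
  have cE' : (\int[Q]_w f (V (maxn N0 N) w))%:E @[N --> \oo] -->
      (\int[Q]_w f (\row_j ginf (i j).1 (i j).2 w))%:E.
    by apply: cvg_EFin; [exact: nearW|exact: cE].
  apply: cvg_trans cE'.
  apply: near_eq_cvg; near=> N.
  have N0N : (N0 <= N)%N by near: N; exact: nbhs_infty_ge.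
  have [mM _ eM] := law N N0N.
  rewrite /= (maxn_idPr N0N) expectation_Rintegral ?eM//.
  by apply: bounded_integrable => //; exists M.
- exact: ginfty_indep.
Unshelve. all: by end_near. Qed.
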